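(* Let $\mathcal{G}=(V,D,B)$ be a mixed graph with $V=\{1,\dots,p\}$, and let $C_1,\dots,C_l$ be the vertex sets of the connected components of its bidirected part $\mathcal{G}_\leftrightarrow=(V,\emptyset,B)$. Then \[ \tau(\mathcal{G}) \;=\; \max_{j=1,\dots,l} |\mathrm{Pa}(C_j)|. \] Moreover, if $n<\tau(\mathcal{G})$, then $\hat\ell(\mathcal{G}\mid S_{0,n})=\infty$ almost surely.
   Context: A mixed graph is a triple $\mathcal{G}=(V,D,B)$ with $V=\{1,\dots,p\}$, $D\subseteq V\times V$ a set of directed edges $i\to j$ (with no self-loops $i\to i$), and $B$ a set of 2-element subsets $\{i,j\}$ of $V$ (bidirected edges $i\leftrightarrow j$). Nodes $i,j$ are adjacent if $i\leftrightarrow j\in B$, $i\to j\in D$ or $j\to i\in D$; connectivity and connected components are with respect to this adjacency (a path uses edges of any type, ignoring orientation). Let $\mathrm{pa}(j)=\{k\in V: k\to j\in D\}$ and, for $A\subseteq V$, $\mathrm{Pa}(A)=A\cup\bigcup_{i\in A}\mathrm{pa}(i)$. Let $\mathbb{R}^D$ be the set of real $p\times p$ matrices $\Lambda=(\lambda_{ij})$ with $\lambda_{ij}=0$ whenever $i\to j\notin D$ (in particular zero diagonal), and $\mathbb{R}^D_{\mathrm{reg}}=\{\Lambda\in\mathbb{R}^D: I-\Lambda \text{ invertible}\}$. Let $PD(B)$ be the set of positive definite $p\times p$ matrices $\Omega=(\omega_{ij})$ with $\omega_{ij}=0$ whenever $i\ne j$ and $\{i,j\}\notin B$. Define $PD(\mathcal{G})=\{(I-\Lambda)^{-T}\Omega(I-\Lambda)^{-1}: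 \Lambda\in\mathbb{R}^D_{\mathrm{reg}},\ \Omega\in PD(B)\}$. For a sample $X^{(1)},\dots,X^{(n)}$ of i.i.d. random vectors in $\mathbb{R}^p$ drawn from an absolutely continuous distribution (e.g. a nondegenerate multivariate normal), let $S_{0,n}=\frac1n\sum_{s=1}^n X^{(s)}(X^{(s)})^T$. For positive definite $\Sigma$ let $\ell(\Sigma\mid S)=-\log\det\Sigma-\mathrm{trace}(\Sigma^{-1}S)$ and $\hat\ell(\mathcal{G}\mid S)=\sup\{\ell(\Sigma\mid S):\Sigma\in PD(\mathcal{G})\}$. ''Almost surely'' (a.s.) refers to this sampling distribution. The maximum likelihood threshold is $\tau(\mathcal{G})=\min\{N\in\mathbb{N}: \hat\ell(\mathcal{G}\mid S_{0,n})<\infty \text{ a.s. for all } n\ge N\}$. *)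

(* Defs.v *)
From HB Require Import structures.
From Stdlib Require Import Reals Lra ClassicalEpsilon FunctionalExtensionality.
From mathcomp Require Import all_boot all_algebra.
Set Implicit Arguments. Unset Strict Implicit. Unset Printing Implicit Defensive.

Definition Req_bool (x y : R) : bool :=
  if Req_EM_T x y then true else false.

Lemma Req_boolP : Equality.axiom Req_bool.
Proof. by move=> x y; rewrite /Req_bool; case: Req_EM_T => h; constructor. Qed.

HB.instance Definition _ := hasDecEq.Build R Req_boolP.

Definition R_find (P : pred R) (n : nat) : option R :=
  match excluded_middle_informative (exists x, P x) with
  | left h => Some (proj1_sig (constructive_indefinite_description _ h))
  | right _ => None
  end.

Lemma R_find_correct P n x : R_find P n = Some x -> P x.
Proof.
rewrite /R_find; case: excluded_middle_informative => // h [<-].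
exact: (proj2_sig (constructive_indefinite_description _ h)).
Qed.

Lemma R_find_complete (P : pred R) : (exists x, P x) -> exists n, R_find P n.
Proof. by move=> h; exists 0%N; rewrite /R_find; case: excluded_middle_informative. Qed.

Lemma R_find_ext (P Q : pred R) : P =1 Q -> R_find P =1 R_find Q.
Proof.
by move=> PQ n; have -> : P = Q by apply: functional_extensionality.
Qed.

HB.instance Definition _ :=
  hasChoice.Build R R_find_correct R_find_complete R_find_ext.

Lemma R_addA : associative Rplus. Proof. move=> *; lra. Qed.
Lemma R_addC : commutative Rplus. Proof. move=> *; lra. Qed.
Lemma R_add0 : left_id R0 Rplus. Proof. move=> *; lra. Qed.
Lemma R_addN : left_inverse R0 Ropp Rplus. Proof. move=> *; lra. Qed.

HB.instance Definition _ :=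
  GRing.isZmodule.Build R R_addA R_addC R_add0 R_addN.

Lemma R_mulA : associative Rmult. Proof. move=> *; ring. Qed.
Lemma R_mulC : commutative Rmult. Proof. move=> *; ring. Qed.
Lemma R_mul1 : left_id R1 Rmult. Proof. move=> *; ring. Qed.
Lemma R_mulDl : left_distributive Rmult Rplus. Proof. move=> *; ring. Qed.
Lemma R_one_neq0 : (R1 : R) != R0.
Proof. by apply/eqP; exact: R1_neq_R0. Qed.

HB.instance Definition _ :=
  GRing.Zmodule_isComNzRing.Build R R_mulA R_mulC R_mul1 R_mulDl R_one_neq0.

Definition R_inv (x : R) : R := if x == R0 then R0 else Rinv x.

Lemma R_mulVf (x : R) : x != R0 -> Rmult (R_inv x) x = R1.
Proof.
move=> hx; rewrite /R_inv (negPf hx); apply: Rinv_l => h.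
by rewrite h eqxx in hx.
Qed.

Lemma R_inv0 : R_inv R0 = R0.
Proof. by rewrite /R_inv eqxx. Qed.

HB.instance Definition _ := GRing.ComNzRing_isField.Build R R_mulVf R_inv0.

Local Open Scope ring_scope.

(* A mixed graph on V = 'I_p (vertex i+1 of the paper is i : 'I_p):
   D i j  <-> i -> j is a directed edge;
   B i j  <-> {i,j} is a bidirected edge (B is symmetric and irreflexive,
              i.e. encodes a set of 2-element subsets of V). *)
Definition mixed_graph (p : nat) (D B : rel 'I_p) : Prop :=
  (forall i, ~~ D i i) /\ (forall i, ~~ B i i) /\ symmetric B.

Definition pa (p : nat) (D : rel 'I_p) (j : 'I_p) : {set 'I_p} :=
  [set k | D k j].
Definition Pa (p : nat) (D : rel 'I_p) (A : {set 'I_p}) : {set 'I_p} :=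
  A :|: \bigcup_(i in A) pa D i.

Definition bcomp (p : nat) (B : rel 'I_p) (v : 'I_p) : {set 'I_p} :=
  [set w | connect B v w].
Definition bcomponents (p : nat) (B : rel 'I_p) : {set {set 'I_p}} :=
  [set bcomp B v | v : 'I_p].

Definition maxPa (p : nat) (D B : rel 'I_p) : nat :=
  \max_(C in bcomponents B) #|Pa D C|.

Definition posdef (p : nat) (A : 'M[R]_p) : Prop :=
  trmx A = A /\
  forall x : 'cV[R]_p, x != 0%R -> Rlt R0 ((trmx x *m A *m x) ord0 ord0).

Definition in_RD (p : nat) (D : rel 'I_p) (L : 'M[R]_p) : Prop :=
  forall i j, ~~ D i j -> L i j = 0%R.
Definition in_RD_reg (p : nat) (D : rel 'I_p) (L : 'M[R]_p) : Prop :=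
  in_RD D L /\ (1%:M - L)%R \in unitmx.
Definition in_PDB (p : nat) (B : rel 'I_p) (O : 'M[R]_p) : Prop :=
  posdef O /\ forall i j, i != j -> ~~ B i j -> O i j = 0%R.

Definition in_PDG (p : nat) (D B : rel 'I_p) (S : 'M[R]_p) : Prop :=
  exists (L O : 'M[R]_p), in_RD_reg D L /\ in_PDB B O /\
    S = (trmx (invmx (1%:M - L)) *m O *m invmx (1%:M - L))%R.

Definition loglik (p : nat) (Sig S : 'M[R]_p) : R :=
  Rminus (Ropp (ln (\det Sig))) (\tr (invmx Sig *m S)).

(* hat l(G | S) < infinity, i.e. sup { l(Sigma|S) : Sigma in PD(G) } is finite
   (PD(G) is nonempty, so this is boundedness from above). *)
Definition ellhat_finite (p : nat) (D B : rel 'I_p) (S : 'M[R]_p) : Prop :=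
  exists M : R, forall Sig, in_PDG D B Sig -> Rle (loglik Sig S) M.

Definition sample_cov (p n : nat) (X : 'I_n -> 'cV[R]_p) : 'M[R]_p :=
  ((n%:R)^-1 *: \sum_(s < n) (X s *m trmx (X s)))%R.

Definition lebesgue_null (I : finType) (N : (I -> R) -> Prop) : Prop :=
  forall eps : R, Rlt R0 eps ->
  exists a b : nat -> I -> R,
    (forall k i, Rle (a k i) (b k i)) /\
    (forall x, N x -> exists k, forall i, Rle (a k i) (x i) /\ Rle (x i) (b k i)) /\
    (forall K : nat, Rle (\sum_(k < K) \prod_(i : I) (b k i - a k i))%R eps).

(* A property of the sample X^(1),...,X^(n) in R^p holds almost surely
   (for i.i.d. draws from any absolutely continuous distribution on R^p)
   iff the set of samples (in R^(n x p)) where it fails is Lebesgue-null. *)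
Definition almost_surely (p n : nat) (P : ('I_n -> 'cV[R]_p) -> Prop) : Prop :=
  lebesgue_null (fun x : 'I_n * 'I_p -> R => ~ P (fun s => \col_i x (s, i))).

Definition as_finite (p : nat) (D B : rel 'I_p) (n : nat) : Prop :=
  almost_surely (fun X : 'I_n -> 'cV[R]_p => ellhat_finite D B (sample_cov X)).

Definition as_infinite (p : nat) (D B : rel 'I_p) (n : nat) : Prop :=
  almost_surely (fun X : 'I_n -> 'cV[R]_p => ~ ellhat_finite D B (sample_cov X)).

(* tau(G) = min { N in {1,2,...} : hat l(G|S_{0,n}) < oo a.s. for all n >= N };
   is_mlt D B t  <->  this minimum exists and equals t. *)
Definition is_mlt (p : nat) (D B : rel 'I_p) (t : nat) : Prop :=
  (0 < t)%N /\ (forall n, (t <= n)%N -> as_finite D B n) /\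
  (forall N, (0 < N)%N -> (forall n, (N <= n)%N -> as_finite D B n) -> (t <= N)%N).

(* Main.v *)
(** Writing [M = 1 - Lambda] and [W = Omega^-1], the concentration matrix is
[K = M W M^T], and the trace term of the likelihood is the average over the
sample of the quadratic form [W] at [M^T X^(s)].

Almost every sample is generic, in the sense that all its square minors are
nonzero: expanding along a row, the zero set of a minor is, away from the zero
set of a smaller minor, a locally Lipschitz graph over the other coordinates.

If [n >= |Pa(C)|] for every component [C], a generic sample spans each
[R^Pa(C)]. As [W] is block diagonal and the columns of [M] indexed by [C] are
supported in [Pa(C)], the trace term dominates a multiple of [tr K]; since
[det K <= p! (tr K)^p], the likelihood is bounded.

If [n < |Pa(C)|], a generic sample is orthogonal to some [v] supported in
[Pa(C)] and nowhere zero on [C]. With [q] the restriction of [v] to [C], some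
[Lambda] gives [(1 - Lambda) q = v], so that all [M^T X^(s)] are orthogonal to
[q]. A Laplacian of the connected bidirected graph on [C] with kernel [q], plus
[e] times the identity, has determinant tending to [0] with [e] while its
inverse stays bounded on the orthogonal complement of [q]: the likelihood is
unbounded. *)

Require Import Defs.
From HB Require Import structures.
From Stdlib Require Import Reals ClassicalEpsilon.
From mathcomp Require Import all_boot all_order all_fingroup all_algebra.
From mathcomp Require Import ring lra.
Set Implicit Arguments. Unset Strict Implicit. Unset Printing Implicit Defensive.
Import Order.TTheory GRing.Theory Num.Theory.
Local Open Scope ring_scope.
(* Otherwise terms of type [R] are parsed with Stdlib's operations. *)
Bind Scope ring_scope with R.
Local Arguments ln _%_ring_scope.
Local Arguments exp _%_ring_scope.

(** * The ordered field structure of the reals *)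

Definition Rle_bool (x y : R) : bool := if Rle_dec x y then true else false.
Definition Rlt_bool (x y : R) : bool := if Rlt_dec x y then true else false.

Lemma Rle_boolP x y : reflect (Rle x y) (Rle_bool x y).
Proof. by rewrite /Rle_bool; case: Rle_dec => h; constructor. Qed.
Lemma Rlt_boolP x y : reflect (Rlt x y) (Rlt_bool x y).
Proof. by rewrite /Rlt_bool; case: Rlt_dec => h; constructor. Qed.

Lemma Rle_bool_add (x y : R) :
  Rle_bool 0 x -> Rle_bool 0 y -> Rle_bool 0 (x + y).
Proof.
move=> /Rle_boolP hx /Rle_boolP hy; apply/Rle_boolP.
exact: Rplus_le_le_0_compat hx hy.
Qed.

Lemma Rle_bool_mul (x y : R) :
  Rle_bool 0 x -> Rle_bool 0 y -> Rle_bool 0 (x * y).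
Proof. by move=> /Rle_boolP hx /Rle_boolP hy; apply/Rle_boolP/Rmult_le_pos. Qed.

Lemma Rle_bool_anti (x : R) : Rle_bool 0 x -> Rle_bool x 0 -> x = 0.
Proof. by move=> /Rle_boolP hx /Rle_boolP hy; exact: Rle_antisym. Qed.

Lemma Rle_bool_sub (x y : R) : Rle_bool 0 (y - x) = Rle_bool x y.
Proof.
by apply/Rle_boolP/Rle_boolP => /Rle_ge h; apply: Rge_le; [exact: Rminus_ge | exact: Rge_minus].
Qed.

Lemma Rle_bool_total (x : R) : Rle_bool 0 x || Rle_bool x 0.
Proof. by case: (Rle_or_lt 0%R x) => [|/Rlt_le] /Rle_boolP ->; rewrite ?orbT. Qed.

Lemma Rabs_ge0_id (x : R) : Rle_bool 0 x -> Rabs x = x.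
Proof. by move=> /Rle_boolP /Rle_ge /Rabs_right. Qed.

Lemma Rlt_bool_def (x y : R) : Rlt_bool x y = (y != x) && Rle_bool x y.
Proof.
apply/Rlt_boolP/andP => [h|[/eqP h1 /Rle_boolP [] // h2]].
  by split; [apply/eqP => e; move: h; rewrite e => /Rlt_irrefl | apply/Rle_boolP/Rlt_le].
by case: h1.
Qed.

HB.instance Definition _ := Num.IntegralDomain_isLeReal.Build R
  Rle_bool_add Rle_bool_mul Rle_bool_anti Rle_bool_sub Rle_bool_total
  Rabs_Ropp Rabs_ge0_id Rlt_bool_def.

Lemma RleP (x y : R) : reflect (Rle x y) (x <= y).
Proof. exact: Rle_boolP. Qed.
Lemma RltP (x y : R) : reflect (Rlt x y) (x < y).
Proof. exact: Rlt_boolP. Qed.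

(** * Quadratic forms *)

Section BilinearForms.
Variables (F : realFieldType) (p : nat).
Implicit Types (W A : 'M[F]_p) (u v y : 'cV[F]_p).

Definition bform W u v : F := (u^T *m W *m v) 0 0.
Definition qform W y : F := bform W y y.
Definition psd W : Prop := forall y, 0 <= qform W y.

Lemma bformDl W u v y : bform W (u + v) y = bform W u y + bform W v y.
Proof. by rewrite /bform linearD !mulmxDl mxE. Qed.

Lemma bformDr W u v y : bform W y (u + v) = bform W y u + bform W y v.
Proof. by rewrite /bform mulmxDr mxE. Qed.

Lemma bformZl W a u y : bform W (a *: u) y = a * bform W u y.
Proof. by rewrite /bform linearZ -!scalemxAl mxE. Qed.

Lemma bformZr W a u y : bform W y (a *: u) = a * bform W y u.
Proof. by rewrite /bform -scalemxAr mxE. Qed.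

Lemma bform_sym W u v : W^T = W -> bform W u v = bform W v u.
Proof.
move=> hW; rewrite /bform -[LHS](mxE trmx_key (fun i j => (u^T *m W *m v) j i)).
by rewrite -/(trmx _) !trmx_mul trmxK hW mulmxA.
Qed.

Lemma bform_delta W i j : bform W (delta_mx i 0) (delta_mx j 0) = W i j.
Proof. by rewrite /bform trmx_delta -rowE -colE !mxE. Qed.

Lemma qform_delta W i : qform W (delta_mx i 0) = W i i.
Proof. exact: bform_delta. Qed.

Lemma qformZ W a y : qform W (a *: y) = a ^+ 2 * qform W y.
Proof. by rewrite /qform bformZl bformZr mulrA expr2. Qed.

Lemma qform0 W : qform W 0 = 0.
Proof. by rewrite /qform /bform mulmx0 mxE. Qed.

Lemma qform_parallelogram W u v :
  qform W (u + v) + qform W (u - v) = 2 * qform W u + 2 * qform W v.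
Proof.
rewrite -[- v]scaleN1r /qform !(bformDl, bformDr, bformZl, bformZr); ring.
Qed.

(** The parallelogram law gives [q(u + v) <= 2 q(u) + 2 q(v)], so each summand costs a factor 2. The
    crude constant depends on neither [W] nor the vectors. *)
Lemma qform_sum_le W (T : Type) (r : seq T) (y : T -> 'cV[F]_p) : psd W ->
  qform W (\sum_(t <- r) y t) <= 2 ^+ size r * \sum_(t <- r) qform W (y t).
Proof.
move=> hW; elim: r => [|t r IHr].
  by rewrite !big_nil qform0 mulr0.
rewrite !big_cons /= exprS.
have := qform_parallelogram W (y t) (\sum_(t <- r) y t).
have := hW (y t - \sum_(t <- r) y t).
have := ler_wpM2r (hW (y t)) (exprn_ege1 (size r) (ler1n F 2)).
rewrite mul1r; move: IHr.
set a := \sum_(_ <- _) qform _ _; set b := qform W (\sum_(_ <- _) _).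
set c := qform W (_ - _); set d := 2 ^+ _; set e := qform W (y t).
by move=> *; rewrite mulrDr; lra.
Qed.

Lemma qform_sum_ord_le W m (y : 'I_m -> 'cV[F]_p) : psd W ->
  qform W (\sum_t y t) <= 2 ^+ m * \sum_t qform W (y t).
Proof.
move=> hW; apply: le_trans (qform_sum_le _ _ hW) _.
by rewrite -sum1_size sum1_card card_ord.
Qed.

(** Positivity at [e_i + e_j] and [e_i - e_j] bounds [2 |W i j|] by [W i i + W j j]. *)
Lemma psd_entry_le W i j : W^T = W -> psd W -> `|W i j| <= \tr W.
Proof.
move=> hs hW.
have hd k : 0 <= W k k by rewrite -qform_delta.
have hk k : W k k <= \tr W.
  by rewrite /mxtrace (bigD1 k) //= lerDl sumr_ge0.
have h1 := hW (delta_mx i 0 + delta_mx j 0).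
have h2 := hW (delta_mx i 0 + (-1) *: delta_mx j 0).
rewrite /qform !(bformDl, bformDr, bformZl, bformZr) !bform_delta in h1 h2.
have hji : W j i = W i j by rewrite -[in LHS]hs mxE.
rewrite hji in h1 h2; have := hk i; have := hk j.
by rewrite ler_norml => *; apply/andP; split; lra.
Qed.

(** Each of the [p!] Leibniz terms is a product of [p] entries, all bounded by the trace. *)
Lemma psd_det_le W : W^T = W -> psd W -> \det W <= (p`!)%:R * \tr W ^+ p.
Proof.
move=> hs hW; apply: le_trans (ler_norm _) _.
apply: le_trans (ler_norm_sum _ _ _) _.
have -> : (p`!)%:R * \tr W ^+ p = \sum_(s : 'S_p) \tr W ^+ p :> F.
  by rewrite big_const iter_addr_0 card_Sn mulr_natl.
apply: ler_sum => s _; rewrite normrMsign normr_prod.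
rewrite -[p in _ ^+ p]card_ord -prodr_const.
by apply: ler_prod => i _; rewrite normr_ge0 psd_entry_le.
Qed.

Lemma mxtrace_qform m (M : 'M[F]_(m, p)) W :
  \tr (M *m W *m M^T) = \sum_k qform W (M^T *m delta_mx k 0).
Proof.
apply: eq_bigr => k _; rewrite /qform /bform trmx_mul trmxK trmx_delta.
by rewrite -!mulmxA [in RHS]mulmxA -rowE !mulmxA -colE -!row_mul [RHS]mxE [RHS]mxE.
Qed.

End BilinearForms.

(** * Positive definite matrices *)

Section PositiveDefinite.
Variable F : realFieldType.

Definition pd p (W : 'M[F]_p) : Prop :=
  W^T = W /\ forall y : 'cV_p, y != 0 -> 0 < qform W y.

Lemma pd_psd p (W : 'M[F]_p) : pd W -> psd W.
Proof.
move=> [_ hW] y; have [->|/hW/ltW//] := eqVneq y 0.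
by rewrite qform0.
Qed.

Lemma pd_unitmx p (W : 'M[F]_p) : pd W -> W \in unitmx.
Proof.
move=> [_ hW]; rewrite unitmxE unitfE; apply/det0P => -[v v0 hv].
have /hW : v^T != 0 by rewrite -(inj_eq (@trmx_inj _ _ _)) trmxK trmx0.
by rewrite /qform /bform trmxK hv mul0mx mxE ltxx.
Qed.

Lemma qform_congr p m (W : 'M[F]_p) (M : 'M[F]_(p, m)) y :
  qform (M^T *m W *m M) y = qform W (M *m y).
Proof. by rewrite /qform /bform trmx_mul !mulmxA. Qed.

Lemma pd_invmx p (W : 'M[F]_p) : pd W -> pd (invmx W).
Proof.
move=> hW; have uW := pd_unitmx hW; have [hs hp] := hW.
have hs' : (invmx W)^T = invmx W by rewrite trmx_inv hs.
split=> // y y0; have -> : invmx W = (invmx W)^T *m W *m invmx W.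
  by rewrite hs' mulVmx // mul1mx.
rewrite qform_congr; apply: hp; apply: contra_neq y0 => h.
by rewrite -(mulKVmx uW y) h mulmx0.
Qed.

(* The corner entry of the inverse is the ratio of the corner minor to the
   determinant, and it is positive. *)
Lemma pd_det_gt0 p (W : 'M[F]_p) : pd W -> 0 < \det W.
Proof.
elim: p W => [|p IHp] W hW; first by rewrite det_mx00.
have uW := pd_unitmx hW; have [hs hp] := hW.
have h1 : 0 < \det (row' 0 (col' 0 W)).
  apply: IHp; split.
    by apply/matrixP => i j; rewrite !mxE -[in RHS]hs mxE.
  move=> y y0; pose M : 'M[F]_(p.+1, p) := \matrix_(i, j) (i == lift 0 j)%:R.
  have -> : row' 0 (col' 0 W) = M^T *m W *m M.
    apply/matrixP => i j; rewrite !mxE (bigD1 (lift 0 j)) //= [X in _ + X]big1.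
      rewrite addr0 !mxE eqxx mulr1 (bigD1 (lift 0 i)) //= big1 => [|k hk].
        by rewrite addr0 !mxE eqxx mul1r.
      by rewrite !mxE (negPf hk) mul0r.
    by move=> k hk; rewrite [M _ _]mxE (negPf hk) mulr0.
  rewrite qform_congr; apply: hp; apply: contra_neq y0 => /matrixP h.
  apply/matrixP => i j; have := h (lift 0 i) j; rewrite !mxE (bigD1 i) //=.
  rewrite mxE eqxx mul1r big1 ?addr0 // => k hk.
  by rewrite mxE (inj_eq lift_inj) eq_sym (negPf hk) mul0r.
have := qform_delta (invmx W) 0.
have d0 : (delta_mx 0 0 : 'cV[F]_p.+1) != 0.
  by apply/eqP => /matrixP /(_ 0 0); rewrite !mxE /= => /eqP; rewrite oner_eq0.
have := (pd_invmx hW).2 _ d0 => /[swap] ->.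
rewrite /invmx uW !mxE /cofactor addn0 expr0 mul1r => h2.
by rewrite pmulr_lgt0 // invr_gt0 in h2.
Qed.

End PositiveDefinite.

(** * Generic samples *)

Section GenericSample.
Variables (F : realFieldType) (n p : nat).
Implicit Types (X : 'I_n -> 'cV[F]_p) (A C : {set 'I_p}).

(** Selections need only be injective: reordering rows or columns changes a minor by a sign. *)
Definition generic X : Prop :=
  forall k (s : 'I_k -> 'I_n) (t : 'I_k -> 'I_p), injective s -> injective t ->
  \det (\matrix_(i, j) X (s i) (t j) 0) != 0.

(** The first [#|A|] observations, restricted to [A], form an invertible matrix; a row of its
    inverse, extended by zero, gives the coefficients. *)
Lemma generic_spans X A k : generic X -> (#|A| <= n)%N -> k \in A ->
  exists a : 'I_n -> F, forall j, j \in A -> \sum_s a s * X s j 0 = (k == j)%:R.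
Proof.
move=> hX hA hk.
pose s : 'I_#|A| -> 'I_n := widen_ord hA; pose t : 'I_#|A| -> 'I_p := enum_val.
have sI : injective s by move=> i j /(congr1 val) /= /val_inj.
have /= := hX _ s t sI (@enum_val_inj _ _).
set Y := \matrix_(i, j) _ => hY.
have uY : Y \in unitmx by rewrite unitmxE unitfE.
pose b := row (enum_rank_in hk k) (invmx Y).
exists (fun s' => \sum_u (s u == s')%:R * b 0 u) => j hj.
have -> : (k == j)%:R = (b *m Y) 0 (enum_rank_in hk j).
  rewrite -row_mul mulVmx // !mxE; congr (nat_of_bool _)%:R.
  by apply/eqP/eqP => [e|/enum_rank_in_inj ->//]; first congr (enum_rank_in _ _).
rewrite mxE; under eq_bigr do rewrite big_distrl /=.
rewrite exchange_big /=; apply: eq_bigr => u _; rewrite (bigD1 (s u)) //=.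
rewrite eqxx mul1r big1 => [|s' hs']; last by rewrite eq_sym (negPf hs') !mul0r.
by rewrite addr0 [Y _ _]mxE /t enum_rankK_in.
Qed.

(** With coordinate [k] set to 1, orthogonality to the sample is a square system in [n] further
    coordinates from [A], whose determinant is a nonzero minor. *)
Lemma generic_kernel X A k : generic X -> (n < #|A|)%N -> k \in A ->
  exists v : 'cV[F]_p, [/\ v k 0 = 1, forall j, j \notin A -> v j 0 = 0
    & forall s, \sum_j X s j 0 * v j 0 = 0].
Proof.
move=> hX hA hk.
have hA' : (n <= #|A :\ k|)%N by rewrite (cardsD1 k A) hk in hA.
pose t (u : 'I_n) := enum_val (widen_ord hA' u).
have tI : injective t by move=> i j /enum_val_inj /(congr1 val) /= /val_inj.
have tA u : t u \in A :\ k by exact: enum_valP.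
have /= := hX _ id t (fun _ _ => id) tI; set Y := \matrix_(i, j) _ => hY.
have uY : Y \in unitmx by rewrite unitmxE unitfE.
pose c := invmx Y *m (\col_s X s k 0).
exists (\col_j ((j == k)%:R - \sum_u (t u == j)%:R * c u 0)); split.
- rewrite mxE eqxx big1 ?subr0 // => u _.
  by have := tA u; rewrite !inE => /andP[/negPf-> _]; rewrite mul0r.
- move=> j hj; rewrite mxE big1 ?subr0 => [|u _].
    by case: eqP hj hk => // -> /negPf ->.
  case: eqP => [e|]; last by rewrite mul0r.
  by have := tA u; rewrite e !inE (negPf hj) andbF.
move=> s; under eq_bigr do rewrite mxE mulrBr.
rewrite sumrB (bigD1 k) //= eqxx mulr1 big1 => [|j /negPf ->]; last by rewrite mulr0.
rewrite addr0; under eq_bigr do rewrite big_distrr /=.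
rewrite exchange_big /=.
have -> : X s k 0 = (Y *m c) s 0 by rewrite /c mulKVmx // mxE.
rewrite [(Y *m c) _ _]mxE; apply/eqP; rewrite subr_eq0; apply/eqP.
apply: eq_bigr => u _; rewrite (bigD1 (t u)) //= eqxx mul1r big1 ?addr0 ?mxE //.
by move=> j /negPf hj; rewrite eq_sym hj mul0r mulr0.
Qed.

Lemma fresh_scalar (r : seq F) : exists a : F, a \notin r.
Proof.
exists (1 + \sum_(x <- r) `|x|); apply/negP => h.
have : `|1 + \sum_(x <- r) `|x| | <= \sum_(x <- r) `|x|.
  rewrite [X in _ <= X](big_rem _ h) /= lerDl.
  by apply: sumr_ge0 => *; exact: normr_ge0.
have : 0 <= \sum_(x <- r) `|x| by apply: sumr_ge0 => *; exact: normr_ge0.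
by move=> h0; rewrite ger0_norm; lra.
Qed.

(** The support grows one node at a time, by adding a multiple of a solution that is 1 at the new
    node. *)
Lemma generic_kernel_support X A C :
  generic X -> (n < #|A|)%N -> C \subset A ->
  exists v : 'cV[F]_p, [/\ forall k, k \in C -> v k 0 != 0,
    forall j, j \notin A -> v j 0 = 0 & forall s, \sum_j X s j 0 * v j 0 = 0].
Proof.
move=> hX hA /subsetP hC.
suff : forall r : seq 'I_p, {subset r <= C} ->
    exists v : 'cV[F]_p, [/\ forall k, k \in r -> v k 0 != 0,
    forall j, j \notin A -> v j 0 = 0 & forall s, \sum_j X s j 0 * v j 0 = 0].
  move=> /(_ (enum C)) []; first by move=> k; rewrite mem_enum.
  by move=> v [h1 h2 h3]; exists v; split=> // k hk; apply: h1; rewrite mem_enum.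
elim=> [|k r IHr] hr.
  exists 0; split=> // [j|s]; first by rewrite mxE.
  by rewrite big1 // => j _; rewrite mxE mulr0.
have [|v [v1 v2 v3]] := IHr; first by move=> j hj; apply: hr; rewrite inE hj orbT.
have hk : k \in A by apply/hC/hr; rewrite inE eqxx.
have [w [w1 w2 w3]] := generic_kernel hX hA hk.
(* The values to avoid cancel coordinate [k], where [w] is 1, or a coordinate [j] secured earlier.
   If [w j 0] is 0, coordinate [j] does not change. *)
have [b hb] := fresh_scalar (- v k 0 :: [seq - v j 0 / w j 0 | j <- r]).
exists (v + b *: w); split => [j||].
- rewrite !inE => /orP[/eqP->|hj]; rewrite !mxE.
    rewrite w1 mulr1; apply: contra hb; rewrite addr_eq0 => /eqP ->.
    by rewrite opprK !inE eqxx.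
  have [w0|w0] := eqVneq (w j 0) 0; first by rewrite w0 mulr0 addr0 v1.
  apply: contra hb => e; rewrite !inE; apply/orP; right.
  apply/mapP; exists j => //; apply: (mulIf w0); rewrite divfK //.
  by apply/eqP; rewrite -addr_eq0 addrC.
- by move=> j hj; rewrite !mxE v2 // w2 // mulr0 addr0.
move=> s; under eq_bigr do rewrite !mxE mulrDr mulrCA.
by rewrite big_split /= v3 -big_distrr /= w3 mulr0 addr0.
Qed.

End GenericSample.

(** * Boundedness of the likelihood *)

Section BoundedLikelihood.
Variables (p : nat) (D B : rel 'I_p).
Hypothesis symB : symmetric B.

(* Indexing blocks by roots makes the projections sum to the identity; the block
   of a non-root is empty. *)
Definition block (r : 'I_p) : {set 'I_p} := [set i | fingraph.root B i == r].
Definition block_proj (r : 'I_p) : 'M[R]_p := diag_mx (\row_i (i \in block r)%:R).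

Lemma block_projE r m (A : 'M[R]_(p, m)) i j :
  (block_proj r *m A) i j = (i \in block r)%:R * A i j.
Proof.
rewrite mxE (bigD1 i) //= !mxE eqxx big1 ?addr0 // => k /negPf hk.
by rewrite !mxE eq_sym hk mul0r.
Qed.

Lemma block_projEr r m (A : 'M[R]_(m, p)) i j :
  (A *m block_proj r) i j = A i j * (j \in block r)%:R.
Proof.
rewrite mxE (bigD1 j) //= !mxE eqxx big1 ?addr0 // => k /negPf hk.
by rewrite !mxE hk mulr0.
Qed.

Lemma tr_block_proj r : (block_proj r)^T = block_proj r.
Proof. exact: tr_diag_mx. Qed.

Lemma block_proj_idem r : block_proj r *m block_proj r = block_proj r.
Proof.
apply/matrixP => i j; rewrite block_projE !mxE.
by case: eqP => [->|]; rewrite ?mulr0 // mulr1n; case: (_ \in _); rewrite ?mulr1 ?mulr0.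
Qed.

Lemma sum_block_proj : \sum_r block_proj r = 1%:M.
Proof.
apply/matrixP => i j; rewrite summxE mxE.
under eq_bigr do rewrite !mxE inE.
rewrite sumrMnl (bigD1 (fingraph.root B i)) //= eqxx big1 ?addr0 // => k.
by rewrite eq_sym => /negPf ->.
Qed.

(** [O] has no entry between distinct bidirected components, so it is block diagonal. *)
Lemma block_proj_comm (O : 'M[R]_p) r :
  (forall i j, i != j -> ~~ B i j -> O i j = 0) ->
  block_proj r *m O = O *m block_proj r.
Proof.
move=> hO; apply/matrixP => i j; rewrite block_projE block_projEr mulrC !inE.
have [->//|ij] := eqVneq i j.
have [Bij|/(hO _ _ ij)->] := boolP (B i j); last by rewrite !mul0r.
by have /(fingraph.rootP (sym_connect_sym symB)) -> := connect1 Bij.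
Qed.

Lemma comm_invmx (O P : 'M[R]_p) :
  O \in unitmx -> P *m O = O *m P -> P *m invmx O = invmx O *m P.
Proof.
by move=> uO h; rewrite -[LHS](mulKmx uO) [O *m _]mulmxA -h mulmxK.
Qed.

(** The cross terms vanish because the projection commutes with [W], so the form splits into two
    nonnegative parts. *)
Lemma qform_block_proj_le (W : 'M[R]_p) r y :
  psd W -> block_proj r *m W = W *m block_proj r ->
  qform W (block_proj r *m y) <= qform W y.
Proof.
move=> hW hc; set P := block_proj r.
have {2}-> : y = P *m y + (1%:M - P) *m y by rewrite -mulmxDl addrC subrK mul1mx.
rewrite /qform bformDl !bformDr -!/(qform _ _).
have PQ : P *m W *m (1%:M - P) = 0.
  by rewrite hc -mulmxA mulmxBr mulmx1 block_proj_idem subrr mulmx0.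
have QP : (1%:M - P) *m W *m P = 0.
  by rewrite -mulmxA -hc mulmxA mulmxBl mul1mx block_proj_idem subrr mul0mx.
have -> : bform W (P *m y) ((1%:M - P) *m y) = 0.
  by rewrite /bform trmx_mul tr_block_proj !mulmxA -2!(mulmxA y^T) PQ mulmx0 mul0mx mxE.
have -> : bform W ((1%:M - P) *m y) (P *m y) = 0.
  rewrite /bform trmx_mul linearB /= trmx1 tr_block_proj !mulmxA -2!(mulmxA y^T).
  by rewrite QP mulmx0 mul0mx mxE.
by rewrite addr0 add0r lerDl.
Qed.

(** Column [i] of [1 - L] is supported on [i] and its parents, so block [r] of the product sees only
    the coordinates in [Pa D (block r)]. *)
Lemma block_proj_local (L : 'M[R]_p) r (u v : 'cV[R]_p) : in_RD D L ->
  (forall j, j \in Pa D (block r) -> u j 0 = v j 0) ->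
  block_proj r *m ((1%:M - L)^T *m u) = block_proj r *m ((1%:M - L)^T *m v).
Proof.
move=> hL huv; apply/matrixP => i j; rewrite !block_projE (ord1 j).
have [hi|_] := boolP (i \in block r); last by rewrite !mul0r.
congr (_ * _); rewrite !mxE; apply: eq_bigr => k _.
have [hk|hk] := boolP (k \in Pa D (block r)); first by rewrite huv.
rewrite !mxE hL ?subr0; last first.
  apply: contra hk => hD; rewrite inE; apply/orP; right.
  by apply/bigcupP; exists i => //; rewrite inE.
have -> : (k == i) = false; last by rewrite !mul0r.
by apply/eqP => e; move: hk; rewrite e inE hi.
Qed.

(** With [M = 1 - L], the trace is the sum of the form at the vectors [M^T e_k]. In block [r] such a
    vector is zero or, by locality, agrees with the image of a combination of the sample. The
    coefficients depend on [r], [k] and [X] alone, so [K] is uniform in [L] and [W]. *)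
Lemma trace_le_qform n (X : 'I_n -> 'cV[R]_p) :
  (forall r k, k \in Pa D (block r) -> exists a : 'I_n -> R,
    forall j, j \in Pa D (block r) -> \sum_s a s * X s j 0 = (k == j)%:R) ->
  exists2 K : R, 0 < K & forall L W, in_RD D L -> psd W ->
    (forall r, block_proj r *m W = W *m block_proj r) ->
    \tr ((1%:M - L) *m W *m (1%:M - L)^T)
      <= K * \sum_s qform W ((1%:M - L)^T *m X s).
Proof.
move=> hX.
(* One choice of coefficients for all pairs, zero where [k] is outside [Pa D (block r)]. *)
have {hX} [a ha] : exists a : 'I_p * 'I_p -> 'I_n -> R, forall rk,
    rk.2 \in Pa D (block rk.1) -> forall j, j \in Pa D (block rk.1) ->
    \sum_s a rk s * X s j 0 = (rk.2 == j)%:R.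
  apply: (@fin_all_exists _ (fun _ => 'I_n -> R)
    (fun rk b => rk.2 \in Pa D (block rk.1) -> forall j, j \in Pa D (block rk.1) ->
    \sum_s b s * X s j 0 = (rk.2 == j)%:R)) => -[r k] /=.
  have [/hX[b hb]|hk] := boolP (k \in Pa D (block r)); first by exists b.
  by exists (fun _ => 0).
pose c (rk : 'I_p * 'I_p) : R := \sum_s a rk s ^+ 2.
have c0 rk : 0 <= c rk by apply: sumr_ge0 => *; exact: sqr_ge0.
pose K : R := \sum_k \sum_r 2 ^+ p * (2 ^+ n * c (r, k)).
have K0 : 0 <= K.
  by do 2!(apply: sumr_ge0 => ? _); rewrite !mulr_ge0 ?exprn_ge0.
exists (1 + K) => [|L W hL hW hc]; first by rewrite ltr_wpDr.
set M := 1%:M - L; set q := \sum_s _.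
have q0 : 0 <= q by apply: sumr_ge0 => *; exact: hW.
rewrite mxtrace_qform mulrDl mul1r; apply: ler_wpDl => //.
rewrite mulr_suml; apply: ler_sum => k _; set e := M^T *m _.
have -> : e = \sum_r block_proj r *m e.
  by rewrite -mulmx_suml sum_block_proj mul1mx.
apply: le_trans (qform_sum_ord_le _ hW) _.
rewrite mulr_sumr mulr_suml; apply: ler_sum => r _.
rewrite -!mulrA ler_wpM2l ?exprn_ge0 //.
have [hk|hk] := boolP (k \in Pa D (block r)); last first.
  rewrite (_ : block_proj r *m e = 0) ?qform0 ?mulr_ge0 ?exprn_ge0 //.
  rewrite -(mulmx0 _ (block_proj r)) -(mulmx0 _ M^T); apply: block_proj_local => //.
  move=> j hj; rewrite !mxE andbT; case: eqP => // e'.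
  by move: hk; rewrite -e' hj.
have -> : block_proj r *m e = \sum_s block_proj r *m (M^T *m (a (r, k) s *: X s)).
  rewrite -!mulmx_sumr; apply: block_proj_local => // j hj.
  rewrite mxE andbT eq_sym summxE -(ha (r, k) hk j hj).
  by apply: eq_bigr => s _; rewrite mxE.
apply: le_trans (qform_sum_ord_le _ hW) _.
rewrite ler_wpM2l ?exprn_ge0 // /q mulr_sumr; apply: ler_sum => s _.
rewrite -!scalemxAr qformZ; apply: ler_pM; rewrite ?sqr_ge0 //.
- rewrite /c (bigD1 s) //= lerDl; apply: sumr_ge0 => *; exact: sqr_ge0.
- exact: qform_block_proj_le.
Qed.

End BoundedLikelihood.

(** * Inequalities for the logarithm *)

Lemma ln_mulr (x y : R) : 0 < x -> 0 < y -> ln (x * y) = ln x + ln y.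
Proof. by move=> /RltP hx /RltP hy; exact: ln_mult. Qed.

Lemma ler_ln (x y : R) : 0 < x -> x <= y -> ln x <= ln y.
Proof.
rewrite le_eqVlt => /RltP hx /orP[/eqP->//|/RltP hxy].
by apply/ltW/RltP; exact: ln_increasing.
Qed.

Lemma ln_invr (x : R) : 0 < x -> ln x^-1 = - ln x.
Proof.
move=> hx; apply/eqP; rewrite -addr_eq0 addrC -ln_mulr ?invr_gt0 //.
by rewrite divff ?lt0r_neq0 //; apply/eqP; exact: ln_1.
Qed.

Lemma ln_exprn (x : R) k : 0 < x -> ln (x ^+ k) = k%:R * ln x.
Proof.
move=> hx; elim: k => [|k IHk]; first by rewrite expr0 mul0r; exact: ln_1.
by rewrite exprS ln_mulr ?exprn_gt0 // IHk -natr1; ring.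
Qed.

Lemma ln_le_subr1 (x : R) : 0 < x -> ln x <= x - 1.
Proof.
move=> /RltP hx; have /RleP := exp_ineq1_le (ln x).
by rewrite exp_ln // lerBrDl.
Qed.

Lemma ln_le0 (x : R) : x <= 0 -> ln x = 0.
Proof.
move=> /RleP hx; rewrite /ln; case: Rlt_dec => // h.
by have := Rlt_irrefl _ (Rlt_le_trans _ _ _ h hx).
Qed.

Lemma posdefP p (A : 'M[R]_p) : posdef A <-> pd A.
Proof.
by split=> -[hs hA]; split=> // x /hA h; apply/RltP.
Qed.

Lemma loglikE p (Sig S : 'M[R]_p) :
  loglik Sig S = - ln (\det Sig) - \tr (invmx Sig *m S).
Proof. by []. Qed.

(** * The likelihood in terms of [Lambda] and [Omega] *)

Section Reparametrization.
Variables (p n : nat) (L O : 'M[R]_p) (X : 'I_n -> 'cV[R]_p).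
Hypotheses (uL : (1%:M - L)%R \in unitmx) (uO : O \in unitmx).
Let M := 1%:M - L.
Let Sig := (invmx M)^T *m O *m invmx M.

Lemma invmx_Sigma : invmx Sig = M *m invmx O *m M^T.
Proof.
have h : M *m invmx O *m M^T *m Sig = 1%:M.
  rewrite /Sig !mulmxA -(mulmxA _ M^T) -trmx_mul mulVmx // trmx1 mulmx1.
  by rewrite -(mulmxA _ _ O) mulVmx // mulmx1 mulmxV.
have uS : Sig \in unitmx by case: (mulmx1_unit h).
by rewrite -[RHS](mulmxK uS) h mul1mx.
Qed.

Lemma trace_Sigma_sample : \tr (invmx Sig *m sample_cov X) =
  n%:R^-1 * \sum_s qform (invmx O) (M^T *m X s).
Proof.
rewrite invmx_Sigma /sample_cov -scalemxAr mxtraceZ mulmx_sumr raddf_sum /=.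
congr (_ * _); apply: eq_bigr => s _.
rewrite mulmxA mxtrace_mulC !mulmxA /mxtrace big_ord1.
by rewrite /qform /bform trmx_mul trmxK !mulmxA.
Qed.

Lemma det_Sigma : \det Sig = (\det M)^-1 ^+ 2 * \det O.
Proof. by rewrite /Sig !det_mulmx det_tr det_inv; ring. Qed.

End Reparametrization.

(** With [t] the trace of the concentration matrix, the log-likelihood is at most
    [ln p! + p ln t - c t], which is bounded in [t]. *)
Lemma ellhat_finite_generic p n (D B : rel 'I_p) (X : 'I_n -> 'cV[R]_p) :
  (0 < p)%N -> (0 < n)%N -> symmetric B -> (maxPa D B <= n)%N -> generic X ->
  ellhat_finite D B (sample_cov X).
Proof.
move=> p0 n0 symB hn hX.
have hPa r : (#|Pa D (block B r)| <= n)%N.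
  (* An index that is not a root has an empty block, with empty [Pa]. *)
  have [->|[i]] := set_0Vmem (block B r).
    rewrite (_ : Pa D set0 = set0) ?cards0 // /Pa set0U.
    by apply/setP => k; rewrite inE; apply/bigcupP => -[i]; rewrite inE.
  rewrite inE => /eqP hi.
  apply: leq_trans hn; apply: (@leq_bigmax_cond _ _ (fun C => #|Pa D C|)).
  apply/imsetP; exists i => //; apply/setP => k; rewrite !inE -hi.
  by rewrite eq_sym root_connect //; exact: sym_connect_sym.
have [|K K0 hK] := @trace_le_qform _ D B n X.
  by move=> r k hk; apply: generic_spans.
have [c c0 cE] : exists2 c : R, 0 < c & c = n%:R^-1 / K.
  by exists (n%:R^-1 / K) => //; rewrite divr_gt0 // invr_gt0 ltr0n.
have pR : 0 < p%:R :> R by rewrite ltr0n.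
exists (`|ln (p`!)%:R| + `|p%:R * ln (p%:R / c)|) => Sig [L [O [[hL uL] [[/posdefP hO BO] eSig]]]].
apply/RleP; rewrite loglikE.
have uO := pd_unitmx hO; set M := 1%:M - L in uL eSig.
have hW := pd_invmx hO.
have hq := hK L (invmx O) hL (pd_psd hW) (fun r => comm_invmx uO (block_proj_comm symB r BO)).
have hinv := invmx_Sigma uL uO; rewrite -/M -eSig in hinv hq.
have htr := trace_Sigma_sample X uL uO; rewrite -/M -eSig in htr.
set q := \sum_s _ in hq htr.
have psdK : psd (invmx Sig).
  move=> y; rewrite hinv -{1}[M]trmxK qform_congr; exact: pd_psd hW _.
have symK : (invmx Sig)^T = invmx Sig.
  by rewrite hinv !trmx_mul trmxK (proj1 hW) mulmxA.
have t0 : 0 <= \tr (invmx Sig).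
  by apply: sumr_ge0 => i _; rewrite -qform_delta.
rewrite -hinv in hq.
have hct : c * \tr (invmx Sig) <= \tr (invmx Sig *m sample_cov X).
  rewrite htr cE -mulrA ler_wpM2l ?invr_ge0 ?ler0n //.
  by rewrite mulrC ler_pdivrMr // mulrC.
have ct0 : 0 <= c * \tr (invmx Sig) by rewrite mulr_ge0 // ltW.
have a1 := ler_norm (ln (p`!)%:R : R); have a2 := ler_norm (p%:R * ln (p%:R / c)).
have a3 := normr_ge0 (ln (p`!)%:R : R); have a4 := normr_ge0 (p%:R * ln (p%:R / c)).
(* In the first case [ln] takes its default value 0, while the claimed bound and the trace term are
   nonnegative. *)
have [d0|d0] := leP (\det Sig) 0; first by rewrite ln_le0 //; lra.
have dK0 : 0 < \det (invmx Sig) by rewrite det_inv invr_gt0.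
rewrite -ln_invr // -det_inv.
have hdet := psd_det_le symK psdK.
set t := \tr (invmx Sig) in t0 hct hdet ct0 *.
have {}t0 : 0 < t.
  rewrite lt_def t0 andbT; apply: contraTneq (lt_le_trans dK0 hdet) => ->.
  by rewrite expr0n (gtn_eqF p0) mulr0 ltxx.
have := ler_ln dK0 hdet; rewrite ln_mulr ?exprn_gt0 ?ltr0n ?fact_gt0 // ln_exprn //.
(* Scaling [t] by [c / p] makes [ln x <= x - 1] yield exactly the linear term [c t]. *)
have -> : ln t = ln (t * c / p%:R) + ln (p%:R / c).
  have h1 : 0 < t * c / p%:R := divr_gt0 (mulr_gt0 t0 c0) pR.
  rewrite -(ln_mulr h1 (divr_gt0 pR c0)); congr (ln _).
  by field; rewrite !gt_eqF.
rewrite mulrDr => h1.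
have : p%:R * ln (t * c / p%:R) <= p%:R * (t * c / p%:R - 1).
  by rewrite ler_wpM2l ?ln_le_subr1 ?(divr_gt0 (mulr_gt0 t0 c0) pR) // ltW.
rewrite mulrBr mulr1 mulrCA divff ?gt_eqF // mulr1 => h2.
move: hct; rewrite (mulrC c) => hct; move: pR a1 a2 a3 a4 h1 h2 hct; clear; lra.
Qed.

(** * Unboundedness of the likelihood *)

Section ShiftedForms.
Variables (F : realFieldType) (p : nat).
Implicit Types (A : 'M[F]_p) (y z : 'cV[F]_p).

Lemma qformD A A' y : qform (A + A') y = qform A y + qform A' y.
Proof. by rewrite /qform /bform mulmxDr mulmxDl mxE. Qed.

Lemma qform_scalar (e : F) y : qform e%:M y = e * \sum_i y i 0 ^+ 2.
Proof.
rewrite /qform /bform mul_mx_scalar -scalemxAl !mxE; congr (_ * _).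
by apply: eq_bigr => i _; rewrite mxE expr2.
Qed.

Lemma psd_shift_pd A (e : F) : A^T = A -> psd A -> 0 < e -> pd (A + e%:M).
Proof.
move=> hs hA e0; split; first by rewrite linearD /= tr_scalar_mx hs.
move=> y y0; rewrite qformD qform_scalar ltr_wpDl // pmulr_rgt0 //.
have h0 i : true -> 0 <= y i 0 ^+ 2 by rewrite sqr_ge0.
rewrite lt_def sumr_ge0 // andbT; apply: contra_neq y0 => /(psumr_eq0P h0) h.
apply/matrixP => i j; rewrite (ord1 j) mxE; apply/eqP.
by rewrite -sqrf_eq0; apply/eqP/h.
Qed.

(** With [u] the preimage of [y] under [A + e], the left side is the pairing of [z] and [u] under
    [A]. It dominates the form [A] at [u], and positivity of [A] at [z - u] concludes. The bound is
    uniform in [e]. *)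
Lemma qform_inv_shift_le A (e : F) y z : A^T = A -> psd A -> 0 < e ->
  A *m z = y -> qform (invmx (A + e%:M)) y <= qform A z.
Proof.
move=> hs hA e0 hz; set E := A + e%:M.
have pdE := psd_shift_pd hs hA e0; have uE := pd_unitmx pdE.
pose u := invmx E *m y; have hu : E *m u = y by rewrite mulKVmx.
have -> : qform (invmx E) y = bform A z u.
  by rewrite /qform /bform -(mulmxA y^T) -/u -hz trmx_mul hs.
have h1 : qform E u = bform A z u.
  by rewrite (bform_sym z u hs) /qform /bform -!mulmxA hu hz.
have h2 : qform A u <= qform E u.
  rewrite qformD qform_scalar lerDl; apply: mulr_ge0; first exact: ltW.
  by apply: sumr_ge0 => *; rewrite sqr_ge0.
have := hA (z + (-1) *: u).
rewrite /qform !(bformDl, bformDr, bformZl, bformZr) -!/(qform _ _).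
by rewrite (bform_sym u z hs); lra.
Qed.

Lemma horner_bounded_unit (r : {poly F}) :
  exists2 b, 0 < b & forall e, 0 <= e <= 1 -> r.[e] <= b.
Proof.
exists (1 + \sum_(i < size r) `|r`_i|) => [|e /andP[e0 e1]].
  by rewrite ltr_wpDr // sumr_ge0.
rewrite horner_coef; apply: ler_wpDl => //; apply: ler_sum => i _.
apply: le_trans (ler_norm _) _; rewrite normrM ler_piMr //.
by rewrite ger0_norm ?exprn_ge0 // exprn_ile1.
Qed.

(** The determinant is the characteristic polynomial of [- A] at [e]. Having the root 0, it is [e]
    times a polynomial bounded on the unit interval. *)
Lemma det_shift_lt A (eta : F) : \det A = 0 -> 0 < eta ->
  exists2 e, 0 < e & \det (A + e%:M) < eta.
Proof.
move=> hA eta0; pose P := char_poly (- A).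
have hP e : P.[e] = \det (A + e%:M).
  rewrite /P /char_poly -[LHS]/(horner_eval e _) -det_map_mx; congr (\det _).
  apply/matrixP => i j; rewrite !mxE /= /horner_eval !hornerE /=.
  by rewrite opprK addrC hornerMn hornerX.
have : root P 0 by rewrite /root hP raddf0 addr0 hA.
move=> /factor_theorem [r hr].
have [b b0 hb] := horner_bounded_unit r.
pose e := Num.min 1 (eta / (2 * b)).
have b2 : 0 < 2 * b by rewrite mulr_gt0.
have e0 : 0 < e by rewrite lt_min ltr01 divr_gt0.
have e1 : e <= 1 by rewrite ge_min lexx.
have e2 : e <= eta / (2 * b) by rewrite ge_min lexx orbT.
exists e => //; rewrite -hP hr hornerM hornerXsubC subr0.
apply: (@le_lt_trans _ _ (b * e)).
  by rewrite ler_wpM2r ?(ltW e0) // hb // e1 (ltW e0).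
rewrite ler_pdivlMr // in e2; move: e2 eta0; lra.
Qed.

(** The range of a symmetric matrix is the orthogonal complement of its kernel; the hypothesis is
    applied to the columns of the cokernel matrix. *)
Lemma sym_range A y : A^T = A ->
  (forall w : 'cV[F]_p, A *m w = 0 -> y^T *m w = 0) -> exists z : 'cV[F]_p, A *m z = y.
Proof.
move=> hs h; have : (y^T <= A)%MS.
  rewrite submxE; apply/eqP/matrixP => i j.
  have /h/matrixP/(_ i 0) : A *m col j (cokermx A) = 0.
    by rewrite colE mulmxA mulmx_coker mul0mx.
  by rewrite colE mulmxA -colE mxE => ->; rewrite !mxE.
by move=> /submxP[z hz]; exists z^T; rewrite -[A]hs -trmx_mul -hz trmxK.
Qed.

End ShiftedForms.

(** * A Laplacian with prescribed kernel *)

Section Laplacian.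
Variables (F : realFieldType) (p : nat) (B : rel 'I_p) (C : {set 'I_p}).
Variable q : 'cV[F]_p.
Hypothesis symB : symmetric B.
Hypothesis q_notin : forall i, i \notin C -> q i 0 = 0.

(** A vector supported on the edge and orthogonal to [q]. *)
Definition edge_vec (i j : 'I_p) : 'cV[F]_p :=
  q j 0 *: delta_mx i 0 - q i 0 *: delta_mx j 0.

(* A weighted Laplacian of the bidirected graph, rescaled by [q] so that
   on a connected component its kernel is spanned by [q] instead of [1]. *)
Definition laplacian : 'M[F]_p :=
  \sum_(e : 'I_p * 'I_p | B e.1 e.2) edge_vec e.1 e.2 *m (edge_vec e.1 e.2)^T
  + \sum_(k | k \notin C) delta_mx k k.

Lemma edge_vec_dot i j (x : 'cV[F]_p) :
  (edge_vec i j)^T *m x = (q j 0 * x i 0 - q i 0 * x j 0)%:M.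
Proof.
have -> : (edge_vec i j)^T = q j 0 *: delta_mx 0 i - q i 0 *: delta_mx 0 j.
  by apply/matrixP => a b; rewrite !mxE !(ord1 a) !eqxx !andbT.
rewrite mulmxBl -!scalemxAl -!rowE.
by apply/matrixP => a b; rewrite !ord1 !mxE eqxx mulr1n.
Qed.

Lemma tr_laplacian : laplacian^T = laplacian.
Proof.
rewrite linearD /= !linear_sum /=; congr (_ + _); apply: eq_bigr => e _.
  by rewrite trmx_mul trmxK.
by rewrite trmx_delta.
Qed.

Lemma qform_laplacian x : qform laplacian x =
  \sum_(e : 'I_p * 'I_p | B e.1 e.2) (q e.2 0 * x e.1 0 - q e.1 0 * x e.2 0) ^+ 2
  + \sum_(k | k \notin C) x k 0 ^+ 2.
Proof.
rewrite qformD; congr (_ + _); rewrite /qform /bform mulmx_sumr mulmx_suml summxE;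
  apply: eq_bigr => e _.
  rewrite mulmxA -mulmxA edge_vec_dot.
  rewrite -[x^T *m _]trmxK trmx_mul trmxK edge_vec_dot tr_scalar_mx.
  by rewrite -scalar_mxM mxE eqxx mulr1n expr2.
rewrite -(mul_delta_mx (0 : 'I_1)) mulmxA -mulmxA -rowE.
rewrite -[x^T *m _]trmxK trmx_mul trmxK trmx_delta -rowE.
by rewrite mxE big_ord1 !mxE expr2.
Qed.

Lemma psd_laplacian : psd laplacian.
Proof.
by move=> x; rewrite qform_laplacian addr_ge0 // sumr_ge0 // => *; rewrite sqr_ge0.
Qed.

Lemma laplacian_q : laplacian *m q = 0.
Proof.
rewrite mulmxDl !mulmx_suml !big1 ?addr0 // => e he.
  rewrite -(mul_delta_mx (0 : 'I_1)) -mulmxA -rowE.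
  by rewrite (_ : row e q = 0) ?mulmx0 //; apply/matrixP => a b; rewrite !mxE ord1 q_notin.
by rewrite -mulmxA edge_vec_dot mulrC subrr raddf0 mulmx0.
Qed.

Lemma laplacian_off i j : i != j -> ~~ B i j -> laplacian i j = 0.
Proof.
move=> ij hB; rewrite mxE !summxE !big1 ?addr0 // => [k _|[a b] /= hab].
  rewrite mxE; case: eqP => // <-; case: eqP => // e.
  by rewrite e eqxx in ij.
rewrite mxE big_ord1 !mxE !andbT.
have e1 c : (i == c) && (j == c) = false.
  by apply/andP => -[/eqP e /eqP e']; rewrite e e' eqxx in ij.
have e2 : (i == a) && (j == b) = false.
  by apply/andP => -[/eqP e /eqP e']; rewrite e e' hab in hB.
have e3 : (i == b) && (j == a) = false.
  by apply/andP => -[/eqP e /eqP e']; rewrite e e' symB hab in hB.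
move: (e1 a) (e1 b) e2 e3.
by case: (i == a) (i == b) (j == a) (j == b) => [] [] [] [] //= _ _ _ _; ring.
Qed.

(** On a null vector every square in the form vanishes: along edges in [C] its ratio to [q] is
    constant, hence constant on [C] by connectedness, and the diagonal terms make it zero outside
    [C]. *)
Lemma laplacian_ker r x : r \in C -> (forall i, i \in C -> connect B r i) ->
  (forall i, i \in C -> q i 0 != 0) ->
  (forall i j, i \in C -> B i j -> j \in C) ->
  laplacian *m x = 0 -> x = (x r 0 / q r 0) *: q.
Proof.
move=> rC conC q0 closC hx.
have : qform laplacian x = 0 by rewrite /qform /bform -mulmxA hx mulmx0 mxE.
rewrite qform_laplacian => /eqP; rewrite paddr_eq0; last 2 first.
- by rewrite sumr_ge0 // => *; rewrite sqr_ge0.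
- by rewrite sumr_ge0 // => *; rewrite sqr_ge0.
move=> /andP[/eqP h1 /eqP h2].
have h1' i j : B i j -> q j 0 * x i 0 = q i 0 * x j 0.
  move=> Bij; apply/eqP; rewrite -subr_eq0 -sqrf_eq0; apply/eqP.
  have := psumr_eq0P _ h1 => /(_ _ (i, j) Bij); apply => *; exact: sqr_ge0.
have h2' k : k \notin C -> x k 0 = 0.
  move=> hk; apply/eqP; rewrite -sqrf_eq0; apply/eqP.
  by have := psumr_eq0P _ h2 => /(_ _ k hk); apply => *; exact: sqr_ge0.
suff hC i : i \in C -> x i 0 = x r 0 / q r 0 * q i 0.
  apply/matrixP => i j; rewrite (ord1 j) [RHS]mxE.
  by have [/hC//|hi] := boolP (i \in C); rewrite h2' // (q_notin hi) mulr0.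
move=> /conC /connectP [s hs ->] {i}.
have : x r 0 = x r 0 / q r 0 * q r 0 by rewrite divfK ?q0.
move: (x r 0 / q r 0) => c; elim: s {conC} r rC hs => //= j s IHs i iC /andP[Bij hs] hi.
have jC := closC _ _ iC Bij.
apply: IHs => //; apply: (mulfI (q0 _ iC)).
by rewrite -h1' // hi; ring.
Qed.

End Laplacian.

(** * Samples orthogonal to a vector supported in [Pa D C] *)

Section UnboundedLikelihood.
Variables (p n : nat) (D B : rel 'I_p) (X : 'I_n -> 'cV[R]_p) (C : {set 'I_p}).
Variables (r : 'I_p) (v : 'cV[R]_p).
Hypotheses (symB : symmetric B).
Hypotheses (rC : r \in C) (conC : forall i, i \in C -> connect B r i).
Hypothesis closC : forall i j, i \in C -> B i j -> j \in C.
Hypotheses (v_neq0 : forall i, i \in C -> v i 0 != 0).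
Hypothesis v_notin : forall i, i \notin Pa D C -> v i 0 = 0.
Hypothesis v_ker : forall s, \sum_j X s j 0 * v j 0 = 0.

Let q : 'cV[R]_p := \col_i (if i \in C then v i 0 else 0).
(** [L] consults this only at nodes of [Pa D C] outside [C], which do have a child in [C]. *)
Let child (k : 'I_p) : 'I_p := odflt r [pick i in C | D k i].
(* Chosen so that [(1 - L) q = v], with [L ^ 2 = 0]. *)
Let L : 'M[R]_p :=
  \matrix_(k, i) (if (k \in Pa D C :\: C) && (i == child k) then - v k 0 / q i 0 else 0).

Let childP k : k \in Pa D C :\: C -> child k \in C /\ D k (child k).
Proof.
rewrite !inE => /andP[kC]; rewrite (negPf kC) /= => /bigcupP[i iC]; rewrite inE => hD.
by rewrite /child; case: pickP => [j /andP[]|/(_ i)] //=; rewrite iC hD.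
Qed.

Let L_RD : in_RD D L.
Proof.
move=> k i hD; rewrite mxE; case: ifP => // /andP[/childP[_ h] /eqP e].
by rewrite e h in hD.
Qed.

Let L_unit : 1%:M - L \in unitmx.
Proof.
(* Nonzero entries of [L] have their row outside [C] and their column in [C]. Hence [1 + L] inverts
   [1 - L]. *)
have L2 : L *m L = 0.
  apply/matrixP => k j; rewrite !mxE big1 // => i _; rewrite !mxE.
  case: ifP => [/andP[/childP[h _] /eqP e]|_]; last by rewrite mul0r.
  by rewrite inE e h mulr0.
suff h : (1%:M - L) *m (1%:M + L) = 1%:M by case: (mulmx1_unit h).
by rewrite mulmxBl mul1mx mulmxDr mulmx1 L2 addr0 addrK.
Qed.

(** On [C] the rows of [L] vanish and [q] equals [v]. At a parent [k] outside [C], [q] is 0 and the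
    only entry of row [k] contributes [v k 0]. Elsewhere both sides are 0. *)
Let Lq : (1%:M - L) *m q = v.
Proof.
apply/matrixP => k j; rewrite (ord1 j) mulmxBl mul1mx mxE [X in _ + X]mxE.
have [kP|kP] := boolP (k \in Pa D C :\: C).
  have [cC _] := childP kP; have kC : k \notin C by move: kP; rewrite inE => /andP[].
  rewrite [(L *m q) _ _]mxE (bigD1 (child k)) //= big1 => [|i /negPf hi]; last first.
    by rewrite mxE hi andbF mul0r.
  have qc : q (child k) 0 != 0 by rewrite mxE cC v_neq0.
  by rewrite [L _ _]mxE kP eqxx /= divfK // [q k 0]mxE (negPf kC) addr0 add0r opprK.
rewrite [(L *m q) _ _]mxE [X in - X]big1 => [|i _]; last first.
  by rewrite mxE (negPf kP) mul0r.
rewrite subr0 mxE; case: ifP => // kC.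
by rewrite v_notin //; apply: contra kP; rewrite in_setD kC.
Qed.

Lemma not_ellhat_finite_kernel : ~ ellhat_finite D B (sample_cov X).
Proof.
move=> [b hb]; set M := 1%:M - L.
have q_notin i : i \notin C -> q i 0 = 0 by move=> hi; rewrite mxE (negPf hi).
have q_neq0 i : i \in C -> q i 0 != 0 by move=> hi; rewrite mxE hi v_neq0.
pose A := laplacian B C q.
have sA : A^T = A := tr_laplacian _ _ _; have pA : psd A := psd_laplacian _ _ _.
(* The kernel of [A] is spanned by [q], and [X s] is orthogonal to [(1 - L) q = v]; so [M^T X s]
   lies in the range of [A]. *)
have [z hz] : exists z : 'I_n -> 'cV[R]_p, forall s, A *m z s = M^T *m X s.
  apply: (@fin_all_exists _ (fun _ => 'cV[R]_p) (fun s z => A *m z = M^T *m X s)) => s.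
  apply: sym_range => // w /(laplacian_ker q_notin rC conC q_neq0 closC) ->.
  rewrite -scalemxAr trmx_mul trmxK -mulmxA Lq.
  suff -> : (X s)^T *m v = 0 by rewrite scaler0.
  apply/matrixP => i j; rewrite !ord1 !mxE -[RHS](v_ker s).
  by apply: eq_bigr => k _; rewrite mxE.
(* A bound on the trace term that holds for every [e]. *)
pose K : R := n%:R^-1 * \sum_s qform A (z s).
pose d := (\det M)^-1 ^+ 2.
have d0 : 0 < d.
  by rewrite lt_def sqr_ge0 andbT sqrf_eq0 invr_eq0 -unitfE -unitmxE.
have detA : \det A = 0.
  apply/eqP/det0P; exists q^T.
    apply/eqP => /matrixP /(_ 0 r) /eqP; rewrite !mxE.
    by rewrite rC (negPf (v_neq0 rC)).
  by rewrite -sA -trmx_mul laplacian_q // trmx0.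
(* Below this value of [\det O], the log-likelihood exceeds the supposed bound [b] by at least 1. *)
have eta0 : 0 < exp (- (b + K + 1)) / d.
  by rewrite divr_gt0 //; apply/RltP; exact: exp_pos.
have [e e0 he] := det_shift_lt detA eta0.
have pdO := psd_shift_pd sA pA e0.
set O := A + e%:M in he pdO.
have uO := pd_unitmx pdO.
pose Sig := (invmx M)^T *m O *m invmx M.
have /hb/RleP : in_PDG D B Sig.
  exists L, O; split; first by split.
  split=> //; split; first exact/posdefP.
  by move=> i j ij hB; rewrite mxE laplacian_off // mxE (negPf ij) addr0.
rewrite loglikE trace_Sigma_sample // det_Sigma // -/M -/d.
have hK : n%:R^-1 * \sum_s qform (invmx O) (M^T *m X s) <= K.
  rewrite ler_wpM2l ?invr_ge0 ?ler0n //; apply: ler_sum => s _.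
  exact: qform_inv_shift_le.
rewrite ltr_pdivlMr // mulrC in he.
have dO : 0 < d * \det O by rewrite mulr_gt0 // pd_det_gt0.
have := ler_ln dO (ltW he); rewrite ln_exp.
move: hK; set a := ln _; set c := _ * \sum_s _; clear; lra.
Qed.

End UnboundedLikelihood.

Lemma ellhat_infinite_generic p n (D B : rel 'I_p) (X : 'I_n -> 'cV[R]_p) :
  symmetric B -> (n < maxPa D B)%N -> generic X ->
  ~ ellhat_finite D B (sample_cov X).
Proof.
move=> symB hn hX.
have [C /imsetP[r _ ->] hC] : exists2 C, C \in bcomponents B & (n < #|Pa D C|)%N.
  apply/exists_inP; apply: contraTT hn; rewrite negb_exists_in => /forall_inP h.
  by rewrite -leqNgt; apply/bigmax_leqP => C /h; rewrite -leqNgt.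
have [|v [v1 v2 v3]] := generic_kernel_support (C := bcomp B r) hX hC.
  exact: subsetUl.
apply: (@not_ellhat_finite_kernel _ _ D B X (bcomp B r) r v) => //.
- by rewrite inE.
- by move=> i; rewrite inE.
by move=> i j; rewrite !inE => hi hB; exact: connect_trans hi (connect1 hB).
Qed.

(** * Null sets *)

Lemma natr_unbounded (x : R) : exists m : nat, x < m%:R.
Proof.
have [m hm] := INR_unbounded x; exists m; apply/RltP.
suff -> : (m%:R : R) = INR m by [].
elim: m {hm} => [|m IHm] //; rewrite -natr1 IHm S_INR; reflexivity.
Qed.

Lemma sum_geometric_half K : \sum_(k < K) 2^-1 ^+ k.+1 = 1 - 2^-1 ^+ K :> R.
Proof.
elim: K => [|K IHK]; first by rewrite big_ord0 expr0 subrr.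
by rewrite big_ord_recr /= IHK exprS; lra.
Qed.

Lemma half_exp_lt (d : R) : 0 < d -> exists m : nat, 2^-1 ^+ m < d.
Proof.
move=> d0; have [m hm] := natr_unbounded d^-1; exists m.
have hm' : m%:R <= 2 ^+ m :> R by rewrite -natrX ler_nat ltnW // ltn_expl.
rewrite exprVn -[d]invrK ltf_pV2 ?posrE ?exprn_gt0 ?invr_gt0 //.
exact: lt_le_trans hm hm'.
Qed.

Lemma sum_subset_le (T : eqType) (s s' : seq T) (f : T -> R) :
  (forall t, 0 <= f t) -> uniq s -> uniq s' -> {subset s <= s'} ->
  \sum_(t <- s) f t <= \sum_(t <- s') f t.
Proof.
move=> f0 us us' ss'; rewrite [X in _ <= X](bigID (mem s)) /= ler_wpDr ?sumr_ge0 //.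
rewrite -[X in _ <= X]big_filter (perm_big (filter (mem s) s')) //=.
apply: uniq_perm => //; first exact: filter_uniq.
move=> t; rewrite mem_filter /= andb_idr //; exact: ss'.
Qed.

Section NullSets.
Variables (I : finType) (i0 : I).
Implicit Types (N : (I -> R) -> Prop) (a b x y : I -> R).

Definition vol a b : R := \prod_i (b i - a i).

Definition box_cover (T : Type) N (a b : T -> I -> R) : Prop :=
  (forall t i, a t i <= b t i) /\
  (forall x, N x -> exists t, forall i, a t i <= x i <= b t i).

Lemma vol_ge0 a b : (forall i, a i <= b i) -> 0 <= vol a b.
Proof. by move=> h; apply: prodr_ge0 => i _; rewrite subr_ge0. Qed.

(** Any countable type may index the boxes. Numbers that code no index get a degenerate box, of
    volume 0 because [I] is inhabited. *)
Lemma null_countable_cover N :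
  (forall eps : R, 0 < eps -> exists (T : countType) (a b : T -> I -> R),
    box_cover N a b /\
    forall s : seq T, uniq s -> \sum_(t <- s) vol (a t) (b t) <= eps) ->
  lebesgue_null N.
Proof.
move=> h eps /RltP /h [T [a [b [[ab hN] hs]]]].
pose a' k := if pickle_inv k is Some t then a t else fun=> 0.
pose b' k := if pickle_inv k is Some t then b t else fun=> 0.
exists a', b'; split=> [k i|]; first by rewrite /a' /b'; apply/RleP; case: pickle_inv.
split=> [x /hN [t ht]|K].
  exists (pickle t) => i; rewrite /a' /b' pickleK_inv.
  by have /andP[/RleP ? /RleP ?] := ht i.
apply/RleP; apply: le_trans (hs (pmap pickle_inv (iota 0 K)) _); last first.
  by apply: (pmap_uniq (@pickle_invK T)); exact: iota_uniq.
rewrite -(big_mkord xpredT (fun k => vol (a' k) (b' k))) /index_iota subn0.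
elim: (iota 0 K) => [|k s IHs]; first by rewrite !big_nil.
rewrite big_cons /= {1}/a' {1}/b'; case: (pickle_inv k) => [t|] /=.
  by rewrite big_cons lerD2l.
by rewrite /vol (bigD1 i0) //= subrr mul0r add0r.
Qed.

Lemma lebesgue_null_cover N (eps : R) : lebesgue_null N -> 0 < eps ->
  exists a b : nat -> I -> R, box_cover N a b /\
    forall K, \sum_(k < K) vol (a k) (b k) <= eps.
Proof.
move=> hN /RltP /hN [a [b [ab [hx hs]]]]; exists a, b; split; last first.
  by move=> K; apply/RleP; exact: hs.
split=> [k i|x /hx [k hk]]; first exact/RleP.
by exists k => i; have [? ?] := hk i; apply/andP; split; apply/RleP.
Qed.

Lemma lebesgue_null_sub N N' :
  (forall x, N x -> N' x) -> lebesgue_null N' -> lebesgue_null N.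
Proof.
move=> h hN eps /hN [a [b [ab [hx hs]]]]; exists a, b; split=> //; split=> //.
by move=> x /h /hx.
Qed.

(** The member with code [k] is covered within [eps / 2^(k+1)]. Finite partial sums are compared
    with sums over a rectangle of index pairs, taken row by row. *)
Lemma lebesgue_null_bigcup (T : countType) (N : T -> (I -> R) -> Prop) :
  (forall t, lebesgue_null (N t)) -> lebesgue_null (fun x => exists t, N t x).
Proof.
move=> hN; apply: null_countable_cover => eps eps0.
pose e (t : T) : R := eps * 2^-1 ^+ (pickle t).+1.
have e0 t : 0 < e t by rewrite mulr_gt0 // exprn_gt0 // invr_gt0.
have h t : exists ab : (nat -> I -> R) * (nat -> I -> R),
    box_cover (N t) ab.1 ab.2 /\
    forall K, \sum_(k < K) vol (ab.1 k) (ab.2 k) <= e t.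
  by have [a [b hab]] := lebesgue_null_cover (hN t) (e0 t); exists (a, b).
pose ab t := proj1_sig (constructive_indefinite_description _ (h t)).
have hab t : box_cover (N t) (ab t).1 (ab t).2 /\
    forall K, \sum_(k < K) vol ((ab t).1 k) ((ab t).2 k) <= e t.
  exact: proj2_sig (constructive_indefinite_description _ (h t)).
exists (T * nat)%type, (fun tk => (ab tk.1).1 tk.2), (fun tk => (ab tk.1).2 tk.2).
split.
  split=> [[t k] i|x [t hx]]; first by have [[]] := hab t.
  by have [[_ /(_ x hx) [k hk]] _] := hab t; exists (t, k).
move=> s us.
pose l := undup (map fst s); pose K := (\max_(k <- map snd s) k).+1.
apply: (@le_trans _ _ (\sum_(t <- l) \sum_(k <- iota 0 K) vol ((ab t).1 k) ((ab t).2 k))).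
  have <- : \sum_(tk <- [seq (t, k) | t <- l, k <- iota 0 K])
      vol ((ab tk.1).1 tk.2) ((ab tk.1).2 tk.2)
    = \sum_(t <- l) \sum_(k <- iota 0 K) vol ((ab t).1 k) ((ab t).2 k).
    by rewrite big_allpairs.
  apply: sum_subset_le => //.
  - by move=> [t k]; apply: vol_ge0 => i; have [[]] := hab t.
  - by apply: allpairs_uniq; rewrite ?undup_uniq ?iota_uniq // => -[? ?] [? ?].
  move=> [t k] htk; apply/allpairsP; exists (t, k); split=> //.
    by rewrite mem_undup; apply/mapP; exists (t, k).
  rewrite mem_iota add0n ltnS /=.
  by apply: (@leq_bigmax_seq _ (map snd s) xpredT id k) => //; apply/mapP; exists (t, k).
apply: (@le_trans _ _ (\sum_(t <- l) e t)).
  apply: ler_sum => t _; have [_ /(_ K)] := hab t.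
  by rewrite -(big_mkord xpredT (fun k => vol ((ab t).1 k) ((ab t).2 k))) /index_iota subn0.
rewrite -big_distrr /= -[X in _ <= X]mulr1 ler_wpM2l ?(ltW eps0) //.
rewrite -(big_map pickle xpredT (fun k => 2^-1 ^+ k.+1 : R)).
pose M := (\max_(k <- map pickle l) k).+1.
apply: (@le_trans _ _ (\sum_(k <- iota 0 M) 2^-1 ^+ k.+1)).
  apply: sum_subset_le.
  - by move=> k; rewrite exprn_ge0 // invr_ge0.
  - by rewrite map_inj_uniq ?undup_uniq //; exact: pcan_inj pickleK.
  - exact: iota_uniq.
  move=> k hk; rewrite mem_iota add0n ltnS /=.
  exact: (@leq_bigmax_seq _ (map pickle l) xpredT id k).
rewrite -[M]subn0 -/(index_iota 0 M) big_mkord sum_geometric_half.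
by rewrite lerBlDr lerDl exprn_ge0 // invr_ge0.
Qed.

Lemma lebesgue_null0 : lebesgue_null (fun _ : I -> R => False).
Proof.
apply: (@lebesgue_null_sub _ (fun x => exists _ : void, False)) => //.
by apply: lebesgue_null_bigcup => -[].
Qed.

End NullSets.

(** * Almost every sample is generic *)

Lemma grid_cell (a h t : R) m : (0 < m)%N -> a <= t <= a + m%:R * h ->
  exists k : 'I_m, a + k%:R * h <= t <= a + k%:R * h + h.
Proof.
case: m => // m _; elim: m => [|m IHm] /andP[h1 h2].
  by exists 0; rewrite mul0r addr0 h1 /=; move: h2; rewrite mul1r.
have [hm|hm] := leP t (a + m.+1%:R * h).
  have [|k hk] := IHm; first by rewrite h1 hm.
  by exists (widen_ord (leqnSn _) k).
exists ord_max; rewrite (ltW hm) /=; move: h2; rewrite -(natr1 m.+1) mulrDl mul1r.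
by rewrite addrA.
Qed.

(** * Lipschitz graphs are null *)

Section LipschitzGraphs.
Variables (I : finType) (i0 : I).
Implicit Types (N : (I -> R) -> Prop) (x y : I -> R).

(** The coordinates other than [i0] are cut into cells of side [h]. Over each cell the set has
    height at most [2 L h], so the total volume is at most [2 L h P], which tends to 0 with [h]. *)
Lemma null_lipschitz_graph N (M L : R) : 0 < M -> 0 <= L ->
  (forall x, N x -> forall i, `|x i| <= M) ->
  (forall x y d, N x -> N y -> 0 <= d ->
    (forall i, i != i0 -> `|x i - y i| <= d) -> `|x i0 - y i0| <= L * d) ->
  lebesgue_null N.
Proof.
move=> M0 L0 bN lipN; apply: (null_countable_cover i0) => eps eps0.
pose P : R := \prod_(i | i != i0) (2 * M).
have P0 : 0 <= P by apply: prodr_ge0 => *; rewrite mulr_ge0 ?(ltW M0).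
have [m' hm'] := natr_unbounded (4 * L * M * P / eps).
pose m := m'.+1; pose h : R := 2 * M / m%:R.
have m0 : 0 < m%:R :> R by rewrite ltr0n.
have h0 : 0 < h by rewrite /h divr_gt0 // mulr_gt0.
have mh : m%:R * h = 2 * M by rewrite /h mulrC divfK ?gt_eqF.
pose lo (k : 'I_m) : R := - M + k%:R * h.
pose cell (c : {ffun I -> 'I_m}) y := N y /\ forall i, i != i0 -> lo (c i) <= y i <= lo (c i) + h.
(* A point of the set over the cell [c] if there is one, and an arbitrary point otherwise. *)
pose Y c := epsilon (inhabits (fun _ : I => 0 : R)) (cell c).
have hY c y : cell c y -> cell c (Y c).
  by move=> hy; apply: (epsilon_spec (inhabits (fun _ : I => 0 : R)) (cell c)); exists y.
(* Cells also carry an index at [i0], so that the total volume factors as a product of sums; only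
   index 0 there gets a box with nonzero height. *)
pose a (c : {ffun I -> 'I_m}) i : R := if i == i0 then
  (if c i0 == 0 then Y c i0 - L * h else 0) else lo (c i).
pose b (c : {ffun I -> 'I_m}) i : R := if i == i0 then
  (if c i0 == 0 then Y c i0 + L * h else 0) else lo (c i) + h.
pose w i (k : 'I_m) : R := if i == i0 then (if k == 0 then 2 * (L * h) else 0) else h.
have ba c i : b c i - a c i = w i (c i).
  rewrite /a /b /w; case: eqP => [->|_]; last by rewrite addrC addKr.
  by case: ifP => _; ring.
have Lh0 : 0 <= L * h by rewrite mulr_ge0 // ltW.
have w0 i k : 0 <= w i k.
  by rewrite /w; case: ifP => _; [case: ifP => _; rewrite // mulr_ge0|exact: ltW].
exists {ffun I -> 'I_m}, a, b; split.
  split=> [c i|x hx]; first by rewrite -subr_ge0 ba.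
  have hk i : exists k : 'I_m, lo k <= x i <= lo k + h.
    apply: grid_cell => //; rewrite mh.
    by have := bN x hx i; rewrite ler_norml => /andP[? ?]; apply/andP; split; lra.
  have [k {}hk] := @fin_all_exists _ (fun _ => 'I_m) (fun i k => lo k <= x i <= lo k + h) hk.
  pose c := [ffun i => if i == i0 then 0 else k i].
  have cx : cell c x by split=> // i /negPf hi; rewrite ffunE hi.
  have [NY cY] := hY _ _ cx.
  exists c => i; rewrite /a /b; case: eqP => [->|/eqP hi]; last exact: (cx.2 _ hi).
  have -> : c i0 = 0 by rewrite ffunE eqxx.
  rewrite eqxx.
  have : `|x i0 - Y c i0| <= L * h.
    apply: lipN => // [|j hj]; first exact: ltW.
    have /andP[? ?] := cx.2 _ hj; have /andP[? ?] := cY _ hj.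
    by rewrite ler_norml; apply/andP; split; lra.
  by rewrite ler_norml => /andP[? ?]; apply/andP; split; lra.
move=> s us; apply: (@le_trans _ _ (\sum_(c : {ffun I -> 'I_m}) vol (a c) (b c))).
  apply: sum_subset_le => //; last by move=> c _; rewrite mem_index_enum.
    by move=> c; apply: vol_ge0 => i; rewrite -subr_ge0 ba.
  exact: index_enum_uniq.
have -> : \sum_(c : {ffun I -> 'I_m}) vol (a c) (b c) = \prod_i \sum_k w i k.
  rewrite bigA_distr_bigA; apply: eq_bigr => c _.
  by apply: eq_bigr => i _; rewrite ba.
rewrite (bigD1 i0) //= (bigD1 0) //= {1}/w eqxx big1 => [|k /negPf hk]; last first.
  by rewrite /w eqxx hk.
rewrite addr0; have -> : \prod_(i | i != i0) \sum_k w i k = P.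
  apply: eq_bigr => i /negPf hi; under eq_bigr do rewrite /w hi.
  by rewrite sumr_const card_ord -[h *+ m]mulr_natl.
rewrite /h (_ : _ * P = 4 * L * M * P / m%:R); last by field; rewrite gt_eqF.
rewrite ler_pdivrMr // [eps * _]mulrC -ler_pdivrMr // (le_trans (ltW hm')) // ler_nat.
exact: leqnSn.
Qed.

(** Lipschitz on each cube with respect to the coordinates other than [i0]. Taking [d = 0] shows
    that [f] does not depend on [x i0]. *)
Definition loc_lipschitz (f : (I -> R) -> R) : Prop :=
  forall M : R, exists2 L : R, 0 <= L & forall x y d,
    (forall i, `|x i| <= M) -> (forall i, `|y i| <= M) -> 0 <= d ->
    (forall i, i != i0 -> `|x i - y i| <= d) -> `|f x - f y| <= L * d.

Lemma loc_lipschitz_ext f g : f =1 g -> loc_lipschitz f -> loc_lipschitz g.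
Proof.
move=> fg hf M; have [L L0 hL] := hf M; exists L => // x y d *.
by rewrite -!fg; apply: hL.
Qed.

Lemma loc_lipschitz_cst c : loc_lipschitz (fun=> c).
Proof. by move=> M; exists 0 => // *; rewrite subrr normr0 mul0r. Qed.

Lemma loc_lipschitz_coord i : i != i0 -> loc_lipschitz (fun x => x i).
Proof. by move=> hi M; exists 1 => // x y d _ _ _ /(_ i hi); rewrite mul1r. Qed.

Lemma loc_lipschitzD f g : loc_lipschitz f -> loc_lipschitz g ->
  loc_lipschitz (fun x => f x + g x).
Proof.
move=> hf hg M; have [L L0 hL] := hf M; have [K K0 hK] := hg M.
exists (L + K) => [|x y d h1 h2 h3 h4]; first exact: addr_ge0.
have := hL x y d h1 h2 h3 h4; have := hK x y d h1 h2 h3 h4.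
rewrite !ler_norml mulrDl => /andP[? ?] /andP[? ?]; apply/andP; split; lra.
Qed.

Lemma loc_lipschitz_bounded f (M : R) : loc_lipschitz f ->
  exists2 b, 0 <= b & forall x, (forall i, `|x i| <= M) -> `|f x| <= b.
Proof.
move=> hf; have [L L0 hL] := hf `|M|.
exists (`|f (fun=> 0)| + L * `|M|) => [|x hx].
  by rewrite addr_ge0 // mulr_ge0.
have hx' i : `|x i| <= `|M| := le_trans (hx i) (ler_norm M).
have := hL x (fun=> 0) `|M| hx' (fun i => _) (normr_ge0 M).
move=> h; have {}h : `|f x - f (fun=> 0)| <= L * `|M|.
  by apply: h => i *; rewrite ?normr0 ?subr0.
by rewrite -[f x](subrK (f (fun=> 0))) addrC (le_trans (ler_normD _ _)) // lerD2l.
Qed.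

Lemma loc_lipschitzM f g : loc_lipschitz f -> loc_lipschitz g ->
  loc_lipschitz (fun x => f x * g x).
Proof.
move=> hf hg M; have [L L0 hL] := hf M; have [K K0 hK] := hg M.
have [bf bf0 hbf] := loc_lipschitz_bounded M hf.
have [bg bg0 hbg] := loc_lipschitz_bounded M hg.
exists (bf * K + bg * L) => [|x y d h1 h2 h3 h4].
  by rewrite addr_ge0 // mulr_ge0.
have -> : f x * g x - f y * g y = f x * (g x - g y) + g y * (f x - f y) by ring.
apply: le_trans (ler_normD _ _) _; rewrite !normrM mulrDl -!mulrA.
by apply: lerD; apply: ler_pM => //; auto.
Qed.

Lemma loc_lipschitz_sum (T : eqType) (r : seq T) (F : T -> (I -> R) -> R) :
  (forall t, t \in r -> loc_lipschitz (F t)) ->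
  loc_lipschitz (fun x => \sum_(t <- r) F t x).
Proof.
elim: r => [|t r IHr] hF.
  by apply: loc_lipschitz_ext (loc_lipschitz_cst 0) => x; rewrite big_nil.
apply: (@loc_lipschitz_ext (fun x => F t x + \sum_(t <- r) F t x)).
  by move=> x; rewrite big_cons.
apply: loc_lipschitzD; first by apply: hF; rewrite inE eqxx.
by apply: IHr => u hu; apply: hF; rewrite inE hu orbT.
Qed.

Lemma loc_lipschitz_prod (T : Type) (r : seq T) (F : T -> (I -> R) -> R) :
  (forall t, loc_lipschitz (F t)) ->
  loc_lipschitz (fun x => \prod_(t <- r) F t x).
Proof.
move=> hF; elim: r => [|t r IHr].
  by apply: loc_lipschitz_ext (loc_lipschitz_cst 1) => x; rewrite big_nil.
apply: (@loc_lipschitz_ext (fun x => F t x * \prod_(t <- r) F t x)).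
  by move=> x; rewrite big_cons.
exact: loc_lipschitzM.
Qed.

Lemma loc_lipschitz_det k (A : (I -> R) -> 'M[R]_k) :
  (forall i j, loc_lipschitz (fun x => A x i j)) ->
  loc_lipschitz (fun x => \det (A x)).
Proof.
move=> hA; apply: loc_lipschitz_sum => s _; apply: loc_lipschitzM.
  exact: loc_lipschitz_cst.
exact: loc_lipschitz_prod.
Qed.

(** Where the coordinates are bounded and [g] is bounded away from 0, the solution [x i0 = - h / g]
    is Lipschitz in the other coordinates. Countably many such pieces exhaust the set. *)
Lemma null_affine_zero g h : loc_lipschitz g -> loc_lipschitz h ->
  lebesgue_null (fun x => x i0 * g x + h x = 0 /\ g x != 0).
Proof.
move=> hg hh.
pose N (m : nat) x := [/\ forall i, `|x i| <= m.+1%:R, 1 <= m.+1%:R * `|g x|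
  & x i0 * g x + h x = 0].
apply: (@lebesgue_null_sub _ _ (fun x => exists m, N m x)).
  move=> x [hx gx]; have [m hm] := natr_unbounded (\sum_i `|x i| + `|g x|^-1).
  have gx0 : 0 < `|g x| by rewrite normr_gt0.
  have s0 : 0 <= \sum_i `|x i| by apply: sumr_ge0 => *; rewrite normr_ge0.
  have g0 : 0 < `|g x|^-1 by rewrite invr_gt0.
  exists m; split=> //.
    move=> i; have : `|x i| <= \sum_i `|x i|.
      by rewrite [X in _ <= X](bigD1 i) //= lerDl sumr_ge0.
    by rewrite -natr1; lra.
  by rewrite mulrC -ler_pdivrMl // mulr1 -natr1; lra.
apply: (lebesgue_null_bigcup i0) => m.
pose M : R := m.+1%:R; have M0 : 0 < M by rewrite ltr0n.
have [K K0 hK] := hg M; have [L L0 hL] := hh M.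
apply: (@null_lipschitz_graph _ M (M * (L + M * K))) => //.
- by rewrite !(mulr_ge0, addr_ge0) // ltW.
- by move=> x [].
move=> x y d [bx gx ex] [bY gy ey] d0 hd.
have h1 := hK x y d bx bY d0 hd; have h2 := hL x y d bx bY d0 hd.
have e : (x i0 - y i0) * g x = - (h x - h y) - y i0 * (g x - g y).
  by move: ex ey => /eqP; rewrite addr_eq0 mulrBl => /eqP -> /eqP; rewrite addr_eq0 mulrBr => /eqP ->; ring.
have : `|(x i0 - y i0) * g x| <= (L + M * K) * d.
  rewrite e (le_trans (ler_normB _ _)) // normrN mulrDl normrM -mulrA.
  by apply: lerD => //; apply: ler_pM.
rewrite normrM => h3.
apply: (@le_trans _ _ (`|x i0 - y i0| * (M * `|g x|))).
  by rewrite ler_peMr.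
by rewrite mulrCA -mulrA ler_wpM2l // ltW.
Qed.

End LipschitzGraphs.

(** * Zero sets of minors *)

Section Minors.
Variables (n p : nat) (i0 : 'I_n * 'I_p).

(** Row expansion makes the minor affine in the entry at [(s 0, t 0)], with a smaller minor as
    coefficient. Injectivity keeps that variable out of the cofactors and of the other entries. *)
Lemma null_minor k (s : 'I_k -> 'I_n) (t : 'I_k -> 'I_p) :
  injective s -> injective t ->
  lebesgue_null (fun x : 'I_n * 'I_p -> R => \det (\matrix_(i, j) x (s i, t j)) = 0).
Proof.
elim: k s t => [|k IHk] s t sI tI.
  apply: lebesgue_null_sub (lebesgue_null0 i0) => x.
  by rewrite det_mx00 => /eqP; rewrite oner_eq0.
pose A (x : 'I_n * 'I_p -> R) : 'M[R]_k.+1 := \matrix_(i, j) x (s i, t j).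
pose g x := cofactor (A x) 0 0.
pose h x := \sum_(j < k) A x 0 (lift 0 j) * cofactor (A x) 0 (lift 0 j).
apply: (@lebesgue_null_sub _ _ (fun x => exists c : bool,
  if c then x (s 0, t 0) * g x + h x = 0 /\ g x != 0 else g x = 0)).
  move=> x; rewrite -/(A x) (expand_det_row _ 0) big_ord_recl => hx.
  have [e|e] := eqVneq (g x) 0; first by exists false.
  by exists true; split=> //; rewrite -[RHS]hx [A x 0 0]mxE.
apply: (lebesgue_null_bigcup i0) => -[]; last first.
  apply: (lebesgue_null_sub _ (IHk (s \o lift 0) (t \o lift 0) _ _)); last 2 first.
  - exact: inj_comp sI lift_inj.
  - exact: inj_comp tI lift_inj.
  move=> x; rewrite /g /cofactor expr0 mul1r => <-; congr (\det _).
  by apply/matrixP => i j; rewrite !mxE.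
have hcof j : loc_lipschitz (s 0, t 0) (fun x => cofactor (A x) 0 j).
  apply: loc_lipschitzM; first exact: loc_lipschitz_cst.
  apply: loc_lipschitz_det => i l.
  apply: loc_lipschitz_ext (loc_lipschitz_coord (i := (s (lift 0 i), t (lift j l))) _).
    by move=> x; rewrite !mxE.
  by apply/eqP => -[/sI].
apply: null_affine_zero; first exact: hcof.
rewrite /h; apply: loc_lipschitz_sum => j _.
apply: loc_lipschitzM => //.
apply: loc_lipschitz_ext (loc_lipschitz_coord (i := (s 0, t (lift 0 j))) _).
  by move=> x; rewrite mxE.
by apply/eqP => -[/tI].
Qed.

(** A countable union over sizes and selections, which are taken as finite functions so as to form a
    countable type. *)
Lemma generic_as : almost_surely (fun X : 'I_n -> 'cV[R]_p => generic X).
Proof.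
apply: (@lebesgue_null_sub _ _ (fun x => exists k : nat,
  exists st : {ffun 'I_k -> 'I_n} * {ffun 'I_k -> 'I_p},
  [/\ injective st.1, injective st.2 & \det (\matrix_(i, j) x (st.1 i, st.2 j)) = 0])).
  move=> x hx; apply: NNPP => hn; apply: hx => k s t sI tI; apply/negP => /eqP e.
  apply: hn; exists k, (finfun s, finfun t); split=> /=.
  - by move=> i j; rewrite !ffunE => /sI.
  - by move=> i j; rewrite !ffunE => /tI.
  by rewrite -[RHS]e; congr (\det _); apply/matrixP => i j; rewrite !mxE !ffunE.
apply: (lebesgue_null_bigcup i0) => k; apply: (lebesgue_null_bigcup i0) => -[s t] /=.
have [sI|sI] := classic (injective s); last first.
  by apply: lebesgue_null_sub (lebesgue_null0 i0) => x [].
have [tI|tI] := classic (injective t); last first.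
  by apply: lebesgue_null_sub (lebesgue_null0 i0) => x [].
by apply: lebesgue_null_sub (null_minor sI tI) => x [].
Qed.

End Minors.

(** * The whole space is not null *)

Section SpaceNotNull.
Variable I : finType.
Implicit Types (a b c : I -> R).

(** The length of the intersection of [[a, b]] and [[c, c + h]]. *)
Definition overlap (a b c h : R) : R :=
  Num.max 0 (Num.min b (c + h) - Num.max a c).

Lemma overlap_ge0 (a b c h : R) : 0 <= overlap a b c h.
Proof. by rewrite le_max lexx. Qed.

Lemma overlap_le (a b c h : R) : a <= b -> overlap a b c h <= b - a.
Proof.
move=> ab; rewrite ge_max subr_ge0 ab /=.
by apply: lerB; rewrite ?ge_min ?le_max lexx.
Qed.

Lemma overlap_inside (a b c h : R) : 0 <= h -> a <= c -> c + h <= b -> overlap a b c h = h.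
Proof.
move=> h0 ac cb; rewrite /overlap (min_idPr cb) (max_idPr ac).
by rewrite addrC addKr; apply/max_idPr.
Qed.

Lemma overlap_split (a b c h : R) : 0 <= h ->
  overlap a b c h + overlap a b (c + h) h = overlap a b c (2 * h).
Proof.
move=> h0; rewrite /overlap (_ : c + 2 * h = c + h + h); last by ring.
case: (leP b (c + h)) => ?; case: (leP b (c + h + h)) => ?;
  case: (leP a c) => ?; case: (leP a (c + h)) => ?;
  rewrite /Order.max; repeat (case: ltP => ?); lra.
Qed.

Lemma exists_widening (w : I -> R) (eta : R) : 0 < eta ->
  exists2 d : R, 0 < d & \prod_i (w i + 2 * d) <= \prod_i w i + eta.
Proof.
(* Continuity in the widening comes from the Lipschitz calculus on two coordinates: [true] is the
   variable and [false] the excluded coordinate. *)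
move=> eta0; pose f (y : bool -> R) := \prod_i (w i + 2 * y true).
have : loc_lipschitz false f.
  apply: loc_lipschitz_prod => i; apply: loc_lipschitzD; first exact: loc_lipschitz_cst.
  apply: loc_lipschitzM; first exact: loc_lipschitz_cst.
  exact: loc_lipschitz_coord.
move=> /(_ 1) [L L0 hL].
have L1 : 0 < L + 1 by rewrite ltr_wpDl.
pose d := Num.min 1 (eta / (L + 1)).
have d0 : 0 < d by rewrite lt_min ltr01 divr_gt0.
have d1 : d <= 1 by rewrite ge_min lexx.
have d2 : d * (L + 1) <= eta by rewrite -ler_pdivlMr // ge_min lexx orbT.
exists d => //.
have := hL (fun=> d) (fun=> 0) d.
rewrite /f normr0 subr0 (gtr0_norm d0) mulr0 => h.
have {h} : `|\prod_i (w i + 2 * d) - \prod_i (w i + 0)| <= L * d.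
  by apply: h => // *; exact: ltW.
under [X in _ - X]eq_bigr do rewrite addr0.
by move=> /(le_trans (ler_norm _)); lra.
Qed.

(** The boxes, counted with multiplicity, fill at most half of the cube with lower corner [c] and
    side [h]. *)
Definition sparse (a b : nat -> I -> R) c (h : R) : Prop :=
  forall K, \sum_(k < K) \prod_i overlap (a k i) (b k i) (c i) h <= 2^-1 * h ^+ #|I|.

(** The [2 ^ #|I|] subcubes split every overlap exactly. If none were sparse, finitely many boxes
    would fill more than half of each, hence of the whole cube. *)
Lemma sparse_halve (a b : nat -> I -> R) c (h : R) : 0 < h ->
  sparse a b c (2 * h) -> exists c', sparse a b c' h /\ forall i, c i <= c' i <= c i + h.
Proof.
move=> h0 hc.
pose c' (s : {ffun I -> bool}) i : R := c i + (s i)%:R * h.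
have hc' s i : c i <= c' s i <= c i + h.
  by rewrite /c'; case: (s i); rewrite ?mul1r ?mul0r ?addr0 ?lexx ?lerDl (ltW h0).
have [[s hs]|hn] := classic (exists s, sparse a b (c' s) h).
  by exists (c' s); split.
have hK s : exists K, 2^-1 * h ^+ #|I| < \sum_(k < K) \prod_i overlap (a k i) (b k i) (c' s i) h.
  apply: NNPP => hK; apply: hn; exists s => K; rewrite leNgt; apply/negP => h1.
  by apply: hK; exists K.
have [K {}hK] := @fin_all_exists _ (fun _ => nat) (fun s K =>
  2^-1 * h ^+ #|I| < \sum_(k < K) \prod_i overlap (a k i) (b k i) (c' s i) h) hK.
pose m := (\max_s K s)%N.
have {}hK s : 2^-1 * h ^+ #|I| < \sum_(k < m) \prod_i overlap (a k i) (b k i) (c' s i) h.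
  apply: lt_le_trans (hK s) _.
  rewrite (big_ord_widen m (fun k => \prod_i overlap (a k i) (b k i) (c' s i) h)) ?leq_bigmax //.
  rewrite [X in _ <= X](bigID (fun k : 'I_m => (k < K s)%N)) /= lerDl.
  by apply: sumr_ge0 => k _; apply: prodr_ge0 => i _; exact: overlap_ge0.
have : \sum_(s : {ffun I -> bool}) 2^-1 * h ^+ #|I| <
    \sum_(s : {ffun I -> bool}) \sum_(k < m) \prod_i overlap (a k i) (b k i) (c' s i) h.
  rewrite (bigD1 [ffun=> true]) //= [X in _ < X](bigD1 [ffun=> true]) //=.
  by apply: ltr_leD => //; apply: ler_sum => s _; exact: ltW.
rewrite exchange_big /= sumr_const card_ffun card_bool -[(_ * _) *+ _]mulr_natr natrX.
rewrite -mulrA -exprMn [h * 2]mulrC ltNge => /negP[]; apply: le_trans (hc m).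
apply: ler_sum => k _.
pose o i (u : bool) := overlap (a k i) (b k i) (c i + u%:R * h) h.
rewrite -(bigA_distr_bigA o) le_eqVlt; apply/orP; left; apply/eqP.
apply: eq_bigr => i _; rewrite big_bool /o /= mul1r mul0r addr0 addrC.
exact/overlap_split/ltW.
Qed.

(* Widening the boxes makes every point interior to one of them, so that the
   nested cubes below eventually lie inside a single box. *)
Lemma space_not_null : ~ lebesgue_null (fun _ : I -> R => True).
Proof.
move=> hN.
have [a [b [[ab cov] hs]]] : exists a b : nat -> I -> R,
    box_cover (fun=> True) a b /\ forall K, \sum_(k < K) vol (a k) (b k) <= 4^-1.
  by apply: lebesgue_null_cover => //; rewrite invr_gt0.
have hd k : exists d : R, 0 < d /\
    \prod_i (b k i - a k i + 2 * d) <= vol (a k) (b k) + 4^-1 * 2^-1 ^+ k.+1.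
  have [|d d0 hd] := @exists_widening (fun i => b k i - a k i) (4^-1 * 2^-1 ^+ k.+1).
    by rewrite mulr_gt0 ?exprn_gt0 ?invr_gt0.
  by exists d.
pose d k := proj1_sig (constructive_indefinite_description _ (hd k)).
have d0 k : 0 < d k by have [] := proj2_sig (constructive_indefinite_description _ (hd k)).
have hd' k : \prod_i (b k i - a k i + 2 * d k) <= vol (a k) (b k) + 4^-1 * 2^-1 ^+ k.+1.
  by have [] := proj2_sig (constructive_indefinite_description _ (hd k)).
pose a' k i := a k i - d k; pose b' k i := b k i + d k.
(* The cover has volume at most 1/4 and widening adds at most 1/4, so half of the unit cube is not
   exceeded. *)
have sp0 : sparse a' b' (fun=> 0) 1.
  move=> K; rewrite expr1n mulr1.
  apply: (@le_trans _ _ (\sum_(k < K) (vol (a k) (b k) + 4^-1 * 2^-1 ^+ k.+1))).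
    apply: ler_sum => k _; apply: le_trans (hd' k); apply: ler_prod => i _.
    rewrite overlap_ge0 /=; apply: le_trans (overlap_le _ _ _) _.
      by rewrite /a' /b'; move: (ab k i) (d0 k); lra.
    by rewrite /a' /b' le_eqVlt; apply/orP; left; apply/eqP; ring.
  rewrite big_split /= -big_distrr /= sum_geometric_half.
  have : 0 <= 2^-1 ^+ K :> R by rewrite exprn_ge0 // invr_ge0.
  by move: (hs K); lra.
pose next c (h : R) := epsilon (inhabits (fun _ : I => 0 : R))
  (fun c' => sparse a' b' c' h /\ forall i, c i <= c' i <= c i + h).
pose c := fix c m := if m is m'.+1 then next (c m') (2^-1 ^+ m) else fun=> 0.
have half_gt0 m : 0 < 2^-1 ^+ m :> R by rewrite exprn_gt0 // invr_gt0.
have hcS m : sparse a' b' (c m) (2^-1 ^+ m) -> sparse a' b' (c m.+1) (2^-1 ^+ m.+1) /\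
    forall i, c m i <= c m.+1 i <= c m i + 2^-1 ^+ m.+1.
  move=> hm; apply: (epsilon_spec (inhabits (fun _ : I => 0 : R)) (fun c' => sparse a' b' c' _ /\ _)).
  apply: sparse_halve => //; rewrite exprS mulrA divff ?mul1r //.
  by rewrite pnatr_eq0.
have hc m : sparse a' b' (c m) (2^-1 ^+ m) by elim: m => [|m /hcS[]].
have hcs m i : c m i <= c m.+1 i <= c m i + 2^-1 ^+ m.+1 by have [_] := hcS m (hc m).
have cmono i m j : c m i <= c (m + j)%N i.
  elim: j => [|j IHj]; first by rewrite addn0.
  by rewrite addnS (le_trans IHj) //; have /andP[] := hcs (m + j)%N i.
have cmono' i m j : c (m + j)%N i + 2^-1 ^+ (m + j) <= c m i + 2^-1 ^+ m.
  elim: j => [|j IHj]; first by rewrite addn0.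
  rewrite addnS (le_trans _ IHj) //; have /andP[_] := hcs (m + j)%N i.
  by rewrite exprS; lra.
have cbound i m j : c j i <= c m i + 2^-1 ^+ m.
  apply: le_trans (cmono i j m) _; apply: le_trans _ (cmono' i m j).
  by rewrite addnC lerDl ltW.
(* The common point of the nested cubes, each coordinate being a supremum of lower corners. *)
have hx i : exists x : R, forall m, c m i <= x <= c m i + 2^-1 ^+ m.
  have [||x [x1 x2]] := completeness (fun t => exists m, t = c m i).
  - by exists (c 0%N i + 2^-1 ^+ 0) => _ [m ->]; apply/RleP; exact: cbound.
  - by exists (c 0%N i), 0%N.
  exists x => m; apply/andP; split; apply/RleP; first by apply: x1; exists m.
  by apply: x2 => _ [j ->]; apply/RleP; exact: cbound.
have [x {}hx] := @fin_all_exists _ (fun _ => R)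
  (fun i t => forall m, c m i <= t <= c m i + 2^-1 ^+ m) hx.
have [k hk] := cov x Logic.I.
(* Once its side is below [d k], the cube lies inside the widened box [k], which then fills it
   entirely, against sparsity. *)
have [m hm] := half_exp_lt (d0 k).
have := hc m k.+1; rewrite big_ord_recr /=.
have -> : \prod_i overlap (a' k i) (b' k i) (c m i) (2^-1 ^+ m) = (2^-1 ^+ m) ^+ #|I|.
  rewrite -prodr_const; apply: eq_bigr => i _.
  have /andP[? ?] := hx i m; have /andP[? ?] := hk i.
  by apply: overlap_inside; rewrite ?(ltW (half_gt0 _)) // /a' /b'; lra.
have : 0 <= \sum_(j < k) \prod_i overlap (a' j i) (b' j i) (c m i) (2^-1 ^+ m).
  by apply: sumr_ge0 => j _; apply: prodr_ge0 => i _; exact: overlap_ge0.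
have : 0 < (2^-1 ^+ m) ^+ #|I| :> R by rewrite exprn_gt0.
by lra.
Qed.

End SpaceNotNull.

(** * The maximum likelihood threshold of a mixed graph *)

Theorem theorem3 (p : nat) (D B : rel 'I_p) :
  (0 < p)%N -> mixed_graph D B ->
  is_mlt D B (maxPa D B) /\
  (forall n : nat, (0 < n)%N -> (n < maxPa D B)%N -> as_infinite D B n).
Proof.
move=> p0 [_ [_ symB]].
have as_generic n : (0 < n)%N -> almost_surely (fun X : 'I_n -> 'cV[R]_p => generic X).
  by move=> n0; exact: generic_as (Ordinal n0, Ordinal p0).
have infinite n : (0 < n)%N -> (n < maxPa D B)%N -> as_infinite D B n.
  move=> n0 hn; apply: lebesgue_null_sub (as_generic n n0) => x h hX; apply: h.
  exact: ellhat_infinite_generic.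
have t0 : (0 < maxPa D B)%N.
  pose i0 := Ordinal p0.
  apply: (@leq_trans #|Pa D (bcomp B i0)|).
    by apply/card_gt0P; exists i0; rewrite !inE connect0.
  apply: (@leq_bigmax_cond _ _ (fun C => #|Pa D C|)); exact: imset_f.
split=> //; split=> //; split=> [n hn|N N0 hN].
  have n0 := leq_trans t0 hn.
  apply: lebesgue_null_sub (as_generic n n0) => x h hX; apply: h.
  exact: ellhat_finite_generic.
(* For [N] below the maximum, the supremum would be almost surely both finite and infinite, making
   the whole sample space a union of two null sets. *)
rewrite leqNgt; apply/negP => ltN.
apply: (@space_not_null ('I_N * 'I_p)%type).
have i0 := (Ordinal N0, Ordinal p0).
pose fin x := ellhat_finite D B (sample_cov (fun s : 'I_N => \col_i x (s, i))).
apply: (@lebesgue_null_sub _ _ (fun x => exists c : bool, if c then ~ fin x else ~ ~ fin x)).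
  by move=> x _; case: (classic (fin x)) => h; [exists false | exists true].
apply: (lebesgue_null_bigcup i0) => -[]; last exact: infinite.
exact: hN.
Qed.
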